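(* Let $d\ge1$, $I=\{1,\dots,d\}$, let $D=\prod_{i=1}^dD_i$ with each $D_i\subset\mathbb{R}$ compact and endowed with a (Borel) probability measure $\nu_i$. Let $Z=(Z_{\mathbf{x}})_{\mathbf{x}\in D}$ be a centred Gaussian random field with covariance function $k$ and with continuous sample paths, and for $u\subseteq I$ let $Z^{(u)}=T_uZ$ (applied pathwise). (a) For any $u\subseteq I$ the following statements are equivalent: (i) $T_u(k(\bullet,\mathbf{y}))=\mathbf{0}$ for every $\mathbf{y}\in D$; (ii) $[T_u\otimes T_u]k=\mathbf{0}$; (iii) $[T_u\otimes T_u]k(\mathbf{x},\mathbf{x})=0$ for every $\mathbf{x}\in D$; (iv) $\mathbb{P}(Z^{(u)}=\mathbf{0})=1$. (b) For any $u,v\subseteq I$ with $u\ne v$ the following statements are equivalent: (i) $[T_u\otimes T_v]k=\mathbf{0}$; (ii) $Z^{(u)}$ and $Z^{(v)}$ are two independent Gaussian random fields.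
   Context: For $u\subseteq I$, $\mathbf{x}_{-u}=(x_i)_{i\in I\setminus u}$ and $\nu_{-u}=\bigotimes_{j\in I\setminus u}\nu_j$; integration against $\nu_{-u'}(\mathrm{d}\mathbf{x}_{-u'})$ integrates out the coordinates $x_j$, $j\notin u'$, leaving the others fixed. $T_u$ is the linear operator on the space $C_b(D)$ of continuous functions $D\to\mathbb{R}$ given by $$(T_uf)(\mathbf{x})=\sum_{u'\subseteq u}(-1)^{|u|-|u'|}\int f(\mathbf{x})\,\nu_{-u'}(\mathrm{d}\mathbf{x}_{-u'}).$$ $T_u(k(\bullet,\mathbf{y}))$ means this formula applied to the function $\mathbf{x}\mapsto k(\mathbf{x},\mathbf{y})$, and $$[T_u\otimes T_v]k(\mathbf{x},\mathbf{y})=\sum_{u'\subseteq u}\sum_{v'\subseteq v}(-1)^{|u|+|v|-|u'|-|v'|}\int k(\mathbf{x},\mathbf{y})\,\nu_{-u'}(\mathrm{d}\mathbf{x}_{-u'})\,\nu_{-v'}(\mathrm{d}\mathbf{y}_{-v'}).$$ $\mathbf{0}$ denotes the zero function. A random field is Gaussian if its finite-dimensional distributions are (possibly degenerate) multivariate normal. *)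

(* Defs.v *)
From HB Require Import structures.
From mathcomp Require Import all_boot all_order all_algebra.
From mathcomp Require Import all_classical all_reals all_analysis.

Set Implicit Arguments.
Unset Strict Implicit.
Unset Printing Implicit Defensive.

Import Order.TTheory GRing.Theory Num.Theory.
Import numFieldNormedType.Exports.

Local Open Scope classical_set_scope.
Local Open Scope ring_scope.

Definition cons_pair d (T : measurableType d) (n : nat)
  (z : T * n.-tuple T) : n.+1.-tuple T := [tuple of z.1 :: z.2].

Lemma measurable_cons_pair d (T : measurableType d) (n : nat) :
  measurable_fun setT (@cons_pair d T n).
Proof. exact: measurable_cons. Qed.

HB.instance Definition _ d (T : measurableType d) (n : nat) :=
  isMeasurableFun.Build _ _ _ _ (@cons_pair d T n) (@measurable_cons_pair d T n).

(* The product measure [mu_0 (x) ... (x) mu_(n-1)] on n-tuples: the push-forward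
   of [mu_0 \x (mu_1 (x) ... (x) mu_(n-1))] under [cons].  It is determined by
   the rectangle rule [prod_probabilityE]. *)
Fixpoint prod_probability d (T : measurableType d) (R : realType) (n : nat) :
    ('I_n -> probability T R) -> probability (n.-tuple T) R :=
  match n return ('I_n -> probability T R) -> probability (n.-tuple T) R with
  | 0 => fun _ => \d_([tuple] : 0.-tuple T)
  | n'.+1 => fun mu =>
      distribution
        ((mu ord0 \x prod_probability (fun i : 'I_n' => mu (lift ord0 i)))%E
          : probability _ R)
        (@cons_pair d T n')
  end.

Lemma prod_probabilityE d (T : measurableType d) (R : realType) (n : nat)
    (mu : 'I_n -> probability T R) (A : 'I_n -> set T) :
  (forall i, measurable (A i)) ->
  prod_probability mu [set t | forall i, A i (tnth t i)]
    = (\prod_(i < n) fine (mu i (A i)))%:E.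
Proof.
elim: n mu A => [|n IH] mu A mA /=.
  rewrite diracE mem_set ?big_ord0 //= => -[] //.
have mtail : measurable
    [set t : n.-tuple T | forall i, A (lift ord0 i) (tnth t i)].
  have -> : [set t : n.-tuple T | forall i, A (lift ord0 i) (tnth t i)] =
      \bigcap_(i in [set: 'I_n]) ((@tnth _ T ^~ i) @^-1` A (lift ord0 i)).
    by apply/seteqP; split => t /= h i; [move=> _|]; exact: h.
  apply: fin_bigcap_measurable => // i _.
  by rewrite -[X in measurable X]setTI; exact: measurable_tnth.
rewrite /distribution /pushforward /=.
have -> : @cons_pair _ T n @^-1` [set t | forall i, A i (tnth t i)] =
    A ord0 `*` [set t : n.-tuple T | forall i, A (lift ord0 i) (tnth t i)].
  apply/seteqP; split => -[a t] /=.
    move=> h; split; first by have := h ord0; rewrite tnth0.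
    by move=> i; have := h (lift ord0 i); rewrite tnthS.
  case=> h0 h i; case: (unliftP ord0 i) => [j ->|->]; last by rewrite tnth0.
  by rewrite tnthS; exact: h.
rewrite product_measure1E //=.
rewrite (IH (fun i => mu (lift ord0 i)) (fun i => A (lift ord0 i))) // big_ord_recl EFinM fineK //.
exact: fin_num_measure.
Qed.

Definition product_set (R : realType) (d : nat) (D : 'I_d -> set R) :
    set 'rV[R]_d :=
  [set x | forall i, D i (x ord0 i)].

(* Points of [prod_(j in A) D_j] and the measure [(x)_(j in A) nu_j] live on
   tuples whose [i]-th entry is the coordinate [enum_val i : 'I_d]. *)
Definition subproduct_set (R : realType) (d : nat) (D : 'I_d -> set R)
    (A : {set 'I_d}) : set (#|A|.-tuple R) :=
  [set t | forall i : 'I_#|A|, D (enum_val i) (tnth t i)].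
Arguments subproduct_set {R d} D A _.

Definition subproduct_probability (R : realType) (d : nat)
    (nu : 'I_d -> probability R R) (A : {set 'I_d}) :
    probability (#|A|.-tuple R) R :=
  prod_probability (fun i : 'I_#|A| => nu (enum_val i)).

(* The point with the coordinates in [A] taken from [t], the others from [x];
   for [j \notin A] the index is out of bounds and [nth] returns [x ord0 j]. *)
Definition set_coords (R : realType) (d : nat) (A : {set 'I_d})
    (x : 'rV[R]_d) (t : #|A|.-tuple R) : 'rV[R]_d :=
  \row_j nth (x ord0 j) t (index j (enum A)).

(* [fun x => \int f(x) nu_(-u)(d x_(-u))] *)
Definition integrate_out (R : realType) (d : nat) (D : 'I_d -> set R)
    (nu : 'I_d -> probability R R) (u : {set 'I_d}) (f : 'rV[R]_d -> R)
    (x : 'rV[R]_d) : R :=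
  \int[subproduct_probability nu (~: u)]_(t in subproduct_set D (~: u))
    f (set_coords x t).

Definition T_op (R : realType) (d : nat) (D : 'I_d -> set R)
    (nu : 'I_d -> probability R R) (u : {set 'I_d}) (f : 'rV[R]_d -> R)
    (x : 'rV[R]_d) : R :=
  \sum_(u' : {set 'I_d} | u' \subset u)
    (-1) ^+ (#|u| - #|u'|) * integrate_out D nu u' f x.

Definition TT_op (R : realType) (d : nat) (D : 'I_d -> set R)
    (nu : 'I_d -> probability R R) (u v : {set 'I_d})
    (k : 'rV[R]_d -> 'rV[R]_d -> R) (x y : 'rV[R]_d) : R :=
  \sum_(u' : {set 'I_d} | u' \subset u)
  \sum_(v' : {set 'I_d} | v' \subset v)
    (-1) ^+ (#|u| + #|v| - #|u'| - #|v'|) *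
    integrate_out D nu v'
      (fun y' => integrate_out D nu u' (fun x' => k x' y') x) y.

(* [normal_prob m 0] is a junk value in the library; a normal law of standard
   deviation [0] is the Dirac mass at its mean. *)
Definition normal_law (R : realType) (m s : R) : set R -> \bar R :=
  if s == 0 then \d_m else normal_prob m s.

Definition normal_variable disp (Omega : measurableType disp) (R : realType)
    (P : probability Omega R) (X : Omega -> R) : Prop :=
  measurable_fun setT X /\
  exists m s : R, 0 <= s /\
    forall B : set R, measurable B -> P (X @^-1` B) = normal_law m s B.

(* Possibly degenerate: every linear combination of the components is
   univariate normal, Dirac masses included. *)
Definition multivariate_normal disp (Omega : measurableType disp)
    (R : realType) (P : probability Omega R) (n : nat)
    (X : 'I_n -> Omega -> R) : Prop :=
  forall c : 'I_n -> R, normal_variable P (fun w => \sum_(i < n) c i * X i w).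

(* Random fields are families indexed by a whole type of which only the members
   with index in [D] matter. *)
Definition gaussian_field disp (Omega : measurableType disp) (R : realType)
    (P : probability Omega R) (E : Type) (D : set E) (Z : E -> Omega -> R) :
    Prop :=
  (forall x, D x -> measurable_fun setT (Z x)) /\
  forall (n : nat) (x : 'I_n -> E), (forall i, D (x i)) ->
    multivariate_normal P (fun i => Z (x i)).

Definition sigma_field disp (Omega : measurableType disp) (R : realType)
    (E : Type) (D : set E) (Z : E -> Omega -> R) : set (set Omega) :=
  <<s \bigcup_(x in D) preimage_set_system setT (Z x) measurable >>.

Definition independent_fields disp (Omega : measurableType disp)
    (R : realType) (P : probability Omega R) (E : Type) (D : set E)
    (Y Z : E -> Omega -> R) : Prop :=
  forall A B : set Omega, sigma_field D Y A -> sigma_field D Z B ->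
    P (A `&` B) = (P A * P B)%E.

(* Main.v *)
Require Import Defs.
From HB Require Import structures.
From mathcomp Require Import all_boot all_order all_algebra.
From mathcomp Require Import all_classical all_reals all_analysis.
From mathcomp Require Import measurable_realfun ring lra zify.

Set Implicit Arguments.
Unset Strict Implicit.
Unset Printing Implicit Defensive.

Import Order.TTheory GRing.Theory Num.Theory.
Import numFieldNormedType.Exports.

Local Open Scope classical_set_scope.
Local Open Scope ring_scope.

(* On functions continuous on [D], the map [f |-> T_u f x] is a limit of finite
   combinations of evaluations at points of [D] (Riemann sums).  Hence all the
   variables [T_u Z x] lie in the closure [V], under pointwise limits of sequences, of
   the linear span of the [Z x].  Such limits of centered Gaussian variables are
   centered Gaussian, with convergence of the second moments; so [V] is a linear space
   of centered Gaussian variables on which the covariance passes to pointwise limits,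
   and [T_u] can be pulled out of it:
     [E (T_u Z x * Y) = T_u (E (Z _ * Y)) x] for [Y] in [V].
   Consequently [T_u (k (_, y)) x] is the covariance of [T_u Z x] and [Z y], and
   [(T_u (x) T_v) k (x, y)] is that of [T_u Z x] and [T_v Z y].  This gives (a), since
   a path of [T_u Z], being continuous, vanishes as soon as it does on a countable
   dense subset of [D].  For (b), if all covariances vanish, the cosines and sines of
   elements of the two families are uncorrelated because
   [E cos X = exp (- E X^2 / 2)], and a multiplicative class argument extends this to
   the generated sigma-algebras. *)

(** * Integrals of real functions *)

(** The obstacle is that [T_u] acts on paths, for each [w] separately, whereas Gaussianity and
    covariances concern finitely many variables at a time. Exchanging expectation and [T_u] by
    Fubini would call for joint measurability of [Z] in [x] and [w]. The Riemann sums avoid this: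
    their nodes and weights do not depend on the function to which they are applied, so one sequence
    of finite combinations serves all [w] at once, and expectation commutes with each of them
    exactly. The price is a limit theorem without a dominating function; it holds because, for
    centered Gaussian variables, pointwise convergence forces the variances to converge. Normal laws
    are handled as images of the standard one under $z \mapsto m + sz$, so that Dirac masses, which
    do arise as limits, are not a separate case. Characteristic functions stay real, since $E \sin X
    = 0$ for centered Gaussian $X$. *)

Section real_integral.
Lemma cvg_EFin_real (R : realType) (u : R^nat) (l : R) :
  u n @[n --> \oo] --> l -> (u n)%:E @[n --> \oo] --> l%:E.
Proof. by move=> ul; apply/cvg_EFin => //; exact: nearW. Qed.

Context d (T : measurableType d) (R : realType).

Lemma cvg_Rintegral_dominated (mu : {measure set T -> \bar R}) (D : set T)
    (f_ : (T -> R)^nat) (f g : T -> R) : measurable D ->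
  (forall n, measurable_fun D (f_ n)) ->
  (forall x, D x -> f_ ^~ x @ \oo --> f x) ->
  mu.-integrable D (EFin \o g) ->
  (forall n x, D x -> `|f_ n x| <= g x) ->
  mu.-integrable D (EFin \o f) /\
  (\int[mu]_(x in D) f_ n x) @[n --> \oo] --> \int[mu]_(x in D) f x.
Proof.
move=> mD mf_ f_f ig f_g.
have mf : measurable_fun D f by exact: measurable_fun_cvg mf_ f_f.
have [|||||intf _ H] := @dominated_convergence _ _ _ mu D mD
  (fun n => EFin \o f_ n) (EFin \o f) (EFin \o g).
- by move=> n; apply/measurable_EFinP; exact: mf_.
- exact/measurable_EFinP.
- by apply: aeW => x Dx; exact/cvg_EFin_real/f_f.
- exact: ig.
- by apply: aeW => x n Dx /=; rewrite lee_fin; exact: f_g.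
split => //.
apply: fine_cvg; rewrite /Rintegral fineK; first exact: H.
exact: integrable_fin_num.
Qed.

Lemma bounded_integrable (P : probability T R) (D : set T) (f : T -> R) (M : R) :
  measurable D -> measurable_fun D f -> (forall x, D x -> `|f x| <= M) ->
  P.-integrable D (EFin \o f).
Proof.
move=> mD mf fM; apply: measurable_bounded_integrable => //.
  by rewrite (le_lt_trans (probability_le1 _ _)) ?ltry.
exists M; split; first exact: num_real.
by move=> y My x Dx /=; rewrite (le_trans (fM _ Dx))// ltW.
Qed.

Lemma Rintegral_cst_probability (P : probability T R) (r : R) :
  \int[P]_w (cst r w) = r.
Proof.
by rewrite Rintegral_cst// [X in fine X]probability_setT mulr1.
Qed.

Lemma cvg_Rintegral_bounded (P : probability T R) (D : set T)
    (f_ : (T -> R)^nat) (f : T -> R) (M : R) : measurable D ->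
  (forall n, measurable_fun D (f_ n)) ->
  (forall x, D x -> f_ ^~ x @ \oo --> f x) ->
  (forall n x, D x -> `|f_ n x| <= M) ->
  (\int[P]_(x in D) f_ n x) @[n --> \oo] --> \int[P]_(x in D) f x.
Proof.
move=> mD mf_ f_f fM.
have [] // := @cvg_Rintegral_dominated P D f_ f (cst M) mD mf_ f_f.
by apply: (@bounded_integrable P D (cst M) `|M|).
Qed.

End real_integral.

Section probability_on_reals.
Context (R : realType).

(** Closed rays are stable under intersection and generate the Borel sets. They suit both uses
    below: increasing affine maps pull them back to rays, and their indicators are limits of
    ramps. *)
Lemma probability_eq_rays (mu nu : probability (measurableTypeR R) R) :
  (forall c : R, mu `[c, +oo[%classic = nu `[c, +oo[%classic) ->
  forall A, measurable A -> mu A = nu A.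
Proof.
move=> munu A mA.
have H (y : R) : - (Num.truncn `|y|).+1%:R <= y.
  by have := truncnS_gt `|y|; have := ler_norm (- y); rewrite normrN; lra.
have := @measure_unique _ R (measurableTypeR R) (@RGenCInfty.G R)
  (fun k : nat => `[(- k%:R : R), +oo[%classic).
move=> U; apply: U => //.
- exact: RGenCInfty.measurableE.
- move=> _ _ [a ->] [b ->]; exists (Num.max a b).
  by apply/seteqP; split => x /=; rewrite !in_itv/= !andbT ge_max => /andP.
- by move=> i; exists (- i%:R).
- apply/seteqP; split => // x _.
  exists (Num.truncn `|x|).+1 => //=; rewrite in_itv/= andbT.
  exact: H.
- by move=> _ [c ->]; exact: munu.
- by move=> k; rewrite (le_lt_trans (probability_le1 _ _)) ?ltry.
Qed.

End probability_on_reals.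

Section normal_density.
Context (R : realType) (m s : R).
Local Notation leb := (@lebesgue_measure R).

(** The Radon-Nikodym derivative agrees almost everywhere with the density, as both have the same
    integral over every measurable set. *)
Lemma integral_normal_prob (f : R -> \bar R) :
  (normal_prob m s).-integrable setT f ->
  (\int[normal_prob m s]_x f x = \int[leb]_x (f x * (normal_pdf m s x)%:E))%E.
Proof.
move=> intf; have dom := normal_prob_dominates m s.
rewrite -(Radon_Nikodym_change_of_variables dom _ intf)//=.
have mpdf := measurable_normal_pdf m s.
have mf := measurable_int _ intf.
apply: ae_eq_integral => //.
- apply: emeasurable_funM; first exact: mf.
  by apply: (measurable_int leb); exact: Radon_Nikodym_integrable.
- by apply: emeasurable_funM => //; exact/measurable_EFinP.
- apply: ae_eqe_mul2l => /=.
  rewrite Radon_NikodymE//=.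
  case: cid => /= h [h1 h2 h3].
  apply: integral_ae_eq => //=; first exact/measurable_EFinP.
  by move=> E _ mE; rewrite -h3.
Qed.

(** This is the tool for proving integrability, so none is assumed: the formula holds for the
    bounded truncations [F n] and passes to the limit by monotone convergence. *)
Lemma ge0_integral_normal_prob (f : R -> R) : measurable_fun setT f ->
  (forall x, 0 <= f x) ->
  (\int[normal_prob m s]_x (f x)%:E = \int[leb]_x (f x * normal_pdf m s x)%:E)%E.
Proof.
move=> mf f0.
pose F n x := Num.min (f x) n%:R.
have mF n : measurable_fun setT (F n) by exact: measurable_minr.
have F0 n x : 0 <= F n x by rewrite /F le_min f0 /=.
have Fh x : {homo F^~ x : n m / (n <= m)%N >-> n <= m}.
  by move=> i j ij; rewrite /F le_min ge_min lexx /= ge_min ler_nat ij orbT.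
have Fl x : F n x @[n --> \oo] --> f x.
  apply: cvg_near_cst; near=> n; rewrite /F min_l//.
  near: n; exact: nbhs_infty_ger.
have step n : (\int[normal_prob m s]_x (F n x)%:E =
    \int[leb]_x (F n x * normal_pdf m s x)%:E)%E.
  rewrite integral_normal_prob //.
  apply: (@bounded_integrable _ _ R (normal_prob m s) setT (F n) n%:R) => //.
    exact: mF.
  by move=> x _; rewrite ger0_norm// /F ge_min lexx orbT.
have c1 : (\int[normal_prob m s]_x (F n x)%:E @[n --> \oo] -->
    \int[normal_prob m s]_x (f x)%:E)%E.
  have -> : (\int[normal_prob m s]_x (f x)%:E =
    \int[normal_prob m s]_x limn (fun n => (F n x)%:E))%E.
    by apply: eq_integral => x _; apply/esym/cvg_lim => //; exact/cvg_EFin_real/Fl.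
  apply: cvg_monotone_convergence => //.
  - by move=> n; apply/measurable_EFinP; exact: mF.
  - by move=> n x _; rewrite lee_fin.
  - by move=> x _ i j ij; rewrite lee_fin; exact: Fh.
have c2 : (\int[leb]_x (F n x * normal_pdf m s x)%:E @[n --> \oo] -->
    \int[leb]_x (f x * normal_pdf m s x)%:E)%E.
  have -> : (\int[leb]_x (f x * normal_pdf m s x)%:E =
    \int[leb]_x limn (fun n => (F n x * normal_pdf m s x)%:E))%E.
    apply: eq_integral => x _; apply/esym/cvg_lim => //; apply: cvg_EFin_real.
    by apply: cvgM; [exact: Fl|exact: cvg_cst].
  apply: cvg_monotone_convergence => //.
  - move=> n; apply/measurable_EFinP; apply: measurable_funM; first exact: mF.
    exact: measurable_normal_pdf.
  - by move=> n x _; rewrite lee_fin mulr_ge0// normal_pdf_ge0.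
  - by move=> x _ i j ij; rewrite lee_fin ler_wpM2r ?normal_pdf_ge0//; exact: Fh.
move: c1; under eq_fun do rewrite step; move=> c1.
exact: (cvg_unique _ c1 c2).
Unshelve. all: by end_near. Qed.

End normal_density.

(** * The standard normal law *)

Section affine_law.
Context (R : realType).

Lemma normal_pdf_affine (m s z : R) : 0 < s ->
  normal_pdf m s (m + s * z) * s = normal_pdf 0 1 z.
Proof.
move=> s0; rewrite !normal_pdfE ?oner_eq0 ?gt_eqF// /normal_peak /normal_fun.
rewrite expr1n mul1r subr0 [m + _]addrC addrK -mulrnAr sqrtrM ?sqr_ge0//.
rewrite sqrtr_sqr gtr0_norm// invfM.
rewrite (_ : - (s * z) ^+ 2 / (s ^+ 2 *+ 2) = - z ^+ 2 / (1 *+ 2)); last by field; rewrite gt_eqF.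
by field; rewrite !gt_eqF// sqrtr_gt0 mulrn_wgt0// pi_gt0.
Qed.

(* [normal_prob] lives on [measurableTypeR R], whose display differs from that of
   the default measurable structure on [R]. *)
Definition affine (m s : R) : measurableTypeR R -> measurableTypeR R :=
  fun z => m + s * z.

Lemma measurable_affine (m s : R) : measurable_fun setT (affine m s).
Proof. by apply: measurable_funD => //; exact: measurable_funM. Qed.

HB.instance Definition _ (m s : R) :=
  isMeasurableFun.Build _ _ _ _ (affine m s) (@measurable_affine m s).

(** On a ray this is the substitution $y = m + sz$, and rays suffice. *)
Lemma normal_prob_affine (m s : R) (B : set R) : 0 < s -> measurable B ->
  normal_prob m s B = normal_prob 0 1 (affine m s @^-1` B).
Proof.
move=> s0 mB.
apply: (@probability_eq_rays R (normal_prob m s)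
  (distribution (normal_prob (0 : R) 1) (affine m s)) _ B mB) => c.
rewrite /distribution /pushforward /=.
pose F : R -> R := affine m s; rewrite -/F.
have F'E : (F^`())%classic = cst s.
  apply/funext => z; rewrite derive1E /F /affine.
  by rewrite deriveD// derive_cst deriveM// derive_cst derive_id scaler0 add0r addr0 /= /GRing.scale/= mulr1.
have dF z : derivable F z 1 by [].
have Fc : F ((c - m) / s) = c by rewrite /F /affine; field; rewrite gt_eqF.
have H (z : R) : (c <= m + s * z) = ((c - m) / s <= z).
  by rewrite ler_pdivrMr// lerBlDl mulrC.
have -> : F @^-1` `[c, +oo[%classic = `[((c - m) / s), +oo[%classic.
  apply/seteqP; split => z /=; rewrite !in_itv/= !andbT /F /affine H//.
rewrite /normal_prob -[in LHS]Fc increasing_ge0_integration_by_substitutiony.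
- apply: eq_integral => z _ /=.
  by rewrite F'E fctE /= normal_pdf_affine.
- by move=> x y _ _ xy; rewrite /F /affine ltrD2l ltr_pM2l.
- by rewrite F'E => ? _; exact: cvg_cst.
- by rewrite F'E; exact: is_cvg_cst.
- by rewrite F'E; exact: is_cvg_cst.
- split; first by [].
  by apply/cvg_at_right_filter/differentiable_continuous/derivable1_diffP.
- apply: (cvg_comp _ _ _ (cvg_addrl m)); apply: gt0_cvgMry => //; exact: cvg_id.
- by apply: continuous_subspaceT; apply: continuous_normal_pdf; rewrite gt_eqF.
- by move=> x _; exact: normal_pdf_ge0.
Qed.

End affine_law.

Section standard_normal.
Context (R : realType).
Local Notation leb := (@lebesgue_measure R).
Local Notation phi := (normal_pdf (0 : R) 1).
Local Notation gamma := (normal_prob (0 : R) 1).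

Lemma normal_pdf01E (z : R) : phi z = normal_peak 1 * expR (- z ^+ 2 / 2).
Proof. by rewrite normal_pdfE ?oner_eq0// /normal_fun subr0 expr1n. Qed.

(** Half of the exponent absorbs the factor: $z^2/4 \le e^{z^2/4}$. The other half, $e^{-z^2/4}$, is
    up to a constant the density of variance 2, whose integral is known; this gives a finite second
    moment. *)
Lemma sqr_normal_pdf_le : exists2 C : R, 0 <= C &
  forall z : R, z ^+ 2 * phi z <= C * normal_pdf 0 (Num.sqrt 2) z.
Proof.
have s0 : Num.sqrt 2 != 0 :> R by rewrite gt_eqF// sqrtr_gt0.
have p0 := normal_peak_gt0 s0; have p1 := normal_peak_gt0 (@oner_neq0 R).
exists (4 * normal_peak 1 / normal_peak (Num.sqrt 2)).
  by rewrite divr_ge0 ?mulr_ge0 ?ltW.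
move=> z; rewrite normal_pdf01E normal_pdfE// /normal_fun subr0 sqr_sqrtr//.
rewrite (_ : _ / _ * _ = normal_peak 1 * (4 * expR (- z ^+ 2 / (2 *+ 2)))); last first.
  by field; rewrite gt_eqF.
rewrite mulrCA ler_pM2l//.
have -> : - z ^+ 2 / 2 = - z ^+ 2 / (2 *+ 2) + - z ^+ 2 / (2 *+ 2) by field.
rewrite expRD mulrA ler_pM2r ?expR_gt0// mulNr expRN -ler_pdivlMr; last first.
  by rewrite invr_gt0 expR_gt0.
rewrite invrK mulrC; have := expR_ge1Dx (z ^+ 2 / (2 *+ 2)).
by have := sqr_ge0 z; rewrite -mulr_natr; lra.
Qed.

Lemma integrable_sqr_normal_prob :
  gamma.-integrable setT (fun z => (z ^+ 2)%:E).
Proof.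
have mX : measurable_fun setT (fun z : R => z ^+ 2) by exact: measurable_funX.
apply/integrableP; split; first exact/measurable_EFinP.
under eq_integral do rewrite /= ger0_norm ?sqr_ge0//.
rewrite ge0_integral_normal_prob => [|//|z]; last exact: sqr_ge0.
have [C C0 HC] := sqr_normal_pdf_le.
have mp m s : measurable_fun setT (fun z => normal_pdf m s z : R) by exact: measurable_normal_pdf.
apply: (@le_lt_trans _ _ (\int[leb]_z (C * normal_pdf 0 (Num.sqrt 2) z)%:E)%E).
  apply: ge0_le_integral => //.
  - by move=> z _; rewrite lee_fin mulr_ge0 ?sqr_ge0 ?normal_pdf_ge0.
  - by apply/measurable_EFinP; apply: measurable_funM; [exact: mX|exact: mp].
  - by apply/measurable_EFinP; apply: measurable_funM => //; exact: mp.
  - by move=> z _; rewrite lee_fin.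
under eq_integral do rewrite EFinM.
rewrite ge0_integralZl//; last 2 first.
  by apply/measurable_EFinP; exact: mp.
  by move=> z _; rewrite lee_fin normal_pdf_ge0.
by rewrite integral_normal_pdf mule1 ltry.
Qed.

Lemma integrable_normal_prob (g : R -> R) (M : R) : measurable_fun setT g ->
  (forall z, `|g z| <= M * (1 + z ^+ 2)) -> gamma.-integrable setT (EFin \o g).
Proof.
move=> mg gM.
apply: (@le_integrable _ _ _ gamma _ _ _ (fun z => (M * (1 + z ^+ 2))%:E)) => //.
- exact/measurable_EFinP.
- by move=> z _; rewrite lee_fin (le_trans (gM z))// ler_norm.
- rewrite (_ : (fun z => _) = fun z => (M%:E * (1%:E + (z ^+ 2)%:E))%E).
    by apply: integrableZl => //; apply: integrableD => //;
      [exact: finite_measure_integrable_cst|exact: integrable_sqr_normal_prob].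
  by apply/funext => z; rewrite -EFinD -EFinM.
Qed.

Lemma Rintegral_normal_prob (g : R -> R) : gamma.-integrable setT (EFin \o g) ->
  leb.-integrable setT (fun z => (g z * phi z)%:E) /\
  \int[gamma]_z g z = \int[leb]_z (g z * phi z).
Proof.
move=> intg; split; last by rewrite /Rintegral integral_normal_prob.
have mg : measurable_fun setT g by apply/measurable_EFinP; exact: measurable_int intg.
have mp : measurable_fun setT phi by exact: measurable_normal_pdf.
apply/integrableP; split; first by apply/measurable_EFinP; exact: measurable_funM.
move/integrableP : intg => [_].
rewrite (_ : (\int[gamma]_z `|_| = \int[gamma]_z (`|g z|)%:E)%E)//.
rewrite ge0_integral_normal_prob//; last exact: measurableT_comp.
by under eq_integral => z _ do rewrite -[X in _ * X](ger0_norm (normal_pdf_ge0 0 1 z)) -normrM.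
Qed.

End standard_normal.

(** * Stein's identity *)

Section stein.
Context (R : realType).
Local Notation leb := (@lebesgue_measure R).
Local Notation phi := (normal_pdf (0 : R) 1).
Local Notation gamma := (normal_prob (0 : R) 1).

Lemma is_derive_normal_pdf01 (z : R) : is_derive z 1 phi (- z * phi z).
Proof.
rewrite normal_pdf01E [X in is_derive _ _ X _](_ : _ =
    (normal_peak 1 *: (expR \o (fun z : R => - z ^+ 2 / 2)))).
  by apply: is_derive_eq; rewrite /GRing.scale /=; field.
by apply/funext => y; rewrite normal_pdf01E.
Qed.

(** From $e^x \ge 1 + x$. Decay of order $z^{-2}$ is enough to beat the linear growth of [F] in the
    boundary terms of Stein's identity. *)
Lemma normal_pdf01_le (z : R) : phi z <= normal_peak 1 / (1 + z ^+ 2 / 2).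
Proof.
have z0 := sqr_ge0 z.
rewrite normal_pdf01E ler_pM2l ?normal_peak_gt0 ?oner_eq0// mulNr expRN.
by rewrite lef_pV2 ?expR_ge1Dx// posrE ?expR_gt0//; lra.
Qed.

(* [(f - z F) phi] is the derivative of [F phi]: integrate it over [[-n, n]]. *)
Lemma stein_identity (F f : R -> R) (A : R) :
  (forall z : R, is_derive z (1 : R) F (f z)) -> continuous f ->
  (forall z, `|F z| <= A * (1 + `|z|)) -> (forall z, `|f z| <= A) ->
  \int[gamma]_z f z = \int[gamma]_z (z * F z).
Proof.
move=> dF cf FA fA.
have A0 : 0 <= A by rewrite (le_trans _ (fA 0)).
have cF : continuous F.
  by move=> z; apply: differentiable_continuous; apply/derivable1_diffP; have [] := dF z.
have mf : measurable_fun setT f by exact: continuous_measurable_fun.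
have mF : measurable_fun setT F by exact: continuous_measurable_fun.
have mzF : measurable_fun setT (fun z : R => z * F z) by exact: measurable_funM.
have if_ : gamma.-integrable setT (EFin \o f).
  apply: (@integrable_normal_prob R f A) => // z; rewrite (le_trans (fA z))//.
  by rewrite ler_peMr//; have := sqr_ge0 z; lra.
have izF : gamma.-integrable setT (EFin \o (fun z : R => z * F z)).
  apply: (@integrable_normal_prob R _ (2 * A)) => // z; rewrite normrM.
  rewrite (@le_trans _ _ (`|z| * (A * (1 + `|z|))))// ?ler_wpM2l//.
  rewrite mulrCA [2 * A]mulrC -mulrA ler_wpM2l//.
  rewrite -[z ^+ 2]real_normK ?num_real//.
  by have := sqr_ge0 (1 - `|z|); nra.
pose h (z : R) := (f z - z * F z) * phi z.
have [ih Hh] := @Rintegral_normal_prob R (fun z : R => f z - z * F z)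
   (integrableB measurableT if_ izF).
suff H0 : \int[leb]_z h z = 0.
  by apply/eqP; rewrite -subr_eq0 -RintegralB// Hh H0.
pose G (z : R) := F z * phi z.
have dG (z : R) : is_derive z (1 : R) G (h z).
  have := is_derive_normal_pdf01 z; have := dF z => ? ?.
  apply: is_derive_eq.
  by rewrite /h /GRing.scale /=; ring.
have ch : continuous h.
  move=> z; apply: cvgM.
    by apply: cvgB; [exact: cf|apply: cvgM; [exact: cvg_id|exact: cF]].
  by apply: continuous_normal_pdf; rewrite oner_eq0.
have cG : continuous G.
  by move=> z; apply: differentiable_continuous; apply/derivable1_diffP; have [] := dG z.
pose I (n : nat) : set R := `[- n.+1%:R, n.+1%:R]%classic.
have FTC n : \int[leb]_(z in I n) h z = G n.+1%:R - G (- n.+1%:R).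
  rewrite /Rintegral (@continuous_FTC2 _ h G)//.
  - by rewrite gtrN.
  - exact: continuous_subspaceT.
  - split; first by move=> z _; have [] := dG z.
      by apply: cvg_at_right_filter; exact: cG.
    by apply: cvg_at_left_filter; exact: cG.
  - by move=> z _; rewrite derive1E; exact: derive_val.
have mh : measurable_fun setT h by exact: continuous_measurable_fun.
have c1 : (\int[leb]_(z in I n) h z) @[n --> \oo] --> \int[leb]_z h z.
  under eq_fun do rewrite Rintegral_mkcond.
  apply: (proj2 (@cvg_Rintegral_dominated _ _ _ leb setT (fun n => h \_ (I n)) h
     (fun z => `|h z|) _ _ _ _ _)) => //.
  - move=> n; apply: (proj1 (@measurable_restrictT _ _ (measurableTypeR R) _ (I n) h (measurable_itv _))).
    by apply: measurable_funTS; exact: mh.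
  - move=> z _; apply: cvg_near_cst; near=> n.
    rewrite patchE ifT// inE /I /= in_itv/= -ler_norml.
    rewrite (@le_trans _ _ n%:R)//; last by rewrite ler_nat.
    near: n; exact: nbhs_infty_ger.
  - exact: (integrable_abse ih).
  - by move=> n z _; rewrite patchE; case: ifP => //; rewrite normr0.
have c2 : (\int[leb]_(z in I n) h z) @[n --> \oo] --> (0 : R).
  under eq_fun do rewrite FTC.
  (* For $k \ge 1$ one has $(1 + k)/(1 + k^2/2) \le 4/k$; the constant 8 below adds up the two
     endpoints. *)
  have bnd n (z : R) : `|z| = n.+1%:R -> `|G z| <= (4 * A * normal_peak 1) * (n.+1%:R)^-1.
    move=> zn; rewrite /G normrM (ger0_norm (normal_pdf_ge0 0 1 z)).
    rewrite (@le_trans _ _ (A * (1 + `|z|) * (normal_peak 1 / (1 + z ^+ 2 / 2))))//.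
      by rewrite ler_pM ?normal_pdf_ge0 ?normal_pdf01_le.
    rewrite -[z ^+ 2]real_normK ?num_real// zn.
    set k := n.+1%:R; have k1 : 1 <= k by rewrite /k ler1n.
    have p0 := normal_peak_ge0 (1 : R).
    rewrite (_ : _ * _ = A * normal_peak 1 * ((1 + k) / (1 + k ^+ 2 / 2))); last by ring.
    rewrite (_ : 4 * A * _ / _ = A * normal_peak 1 * (4 / k)); last by ring.
    apply: ler_wpM2l; first exact: mulr_ge0.
    rewrite ler_pdivrMr; last by have := sqr_ge0 k; lra.
    rewrite mulrAC ler_pdivlMr; last by lra.
    nra.
  apply/norm_cvg0P; apply: (@squeeze_cvgr _ _ _ _ (cst 0)
    (fun n => (8 * A * normal_peak 1) * harmonic n)); last 2 first.
  - exact: cvg_cst.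
  - rewrite -[X in _ --> X](mulr0 (8 * A * normal_peak 1)).
    by apply: cvgM; [exact: cvg_cst|exact: cvg_harmonic].
  apply: nearW => n; rewrite normr_ge0/= (le_trans (ler_normB _ _))//.
  have b1 := bnd n n.+1%:R (normr_nat _ _).
  have e2 : `|- n.+1%:R| = n.+1%:R :> R by rewrite normrN normr_nat.
  rewrite (le_trans (lerD b1 (bnd n _ e2)))// /harmonic /= le_eqVlt.
  by apply/orP; left; apply/eqP; field; rewrite addrC natr1 pnatr_eq0.
exact: (cvg_unique _ c1 c2).
Unshelve. all: by end_near. Qed.

End stein.

Section characteristic_function.
Context (R : realType).
Local Notation gamma := (normal_prob (0 : R) 1).

Lemma normr_le_sqr (x : R) : `|x| <= 1 + x ^+ 2.
Proof.
by have := sqr_ge0 (1 - `|x|); have := sqr_ge0 x; rewrite -(real_normK (num_real x)); nra.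
Qed.

(** The phase [t] lets one computation cover cosines and sines, since $\sin x = \cos(x - \pi/2)$. *)
Lemma stein_sin (s t : R) :
  \int[gamma]_z (z * sin (s * z + t)) = s * \int[gamma]_z cos (s * z + t).
Proof.
have mcos : measurable_fun setT (fun z : R => cos (s * z + t)).
  apply: continuous_measurable_fun => z; apply: continuous_comp; last exact: continuous_cos.
  by apply: cvgD; [apply: cvgM; [exact: cvg_cst|exact: cvg_id]|exact: cvg_cst].
rewrite -RintegralZl//; last first.
  apply: (@integrable_normal_prob R _ 1) => // z.
  by rewrite mul1r (le_trans (cos_max _))//; have := sqr_ge0 z; lra.
apply/esym; apply: (@stein_identity R (fun z => sin (s * z + t)) (fun z => s * cos (s * z + t)) (1 + `|s|)).
- move=> z; apply: is_derive_eq.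
  by rewrite /GRing.scale /=; ring.
- move=> z; apply: cvgM; first exact: cvg_cst.
  apply: continuous_comp; last exact: continuous_cos.
  by apply: cvgD; [apply: cvgM; [exact: cvg_cst|exact: cvg_id]|exact: cvg_cst].
- move=> z; rewrite (le_trans (sin_max _))//.
  by have := normr_ge0 s; have := normr_ge0 z; nra.
- move=> z; rewrite normrM (@le_trans _ _ (`|s| * 1))//; last by lra.
  by rewrite ler_wpM2l// cos_max.
Qed.

(* By Stein's identity the left-hand side [C] solves [C' = - s C]. *)
Lemma integral_cos_normal_prob (s t : R) :
  \int[gamma]_z cos (s * z + t) = cos t * expR (- s ^+ 2 / 2).
Proof.
pose C (x : R) := \int[gamma]_z cos (x * z + t).
have iz : gamma.-integrable setT (EFin \o (fun z : R => `|z|)).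
  apply: (@integrable_normal_prob R _ 1) => // z.
  by rewrite normr_id mul1r normr_le_sqr.
have ic (x : R) : gamma.-integrable setT (EFin \o (fun z : R => cos (x * z + t))).
  apply: (@integrable_normal_prob R _ 1) => // [|z].
    apply: continuous_measurable_fun => z; apply: continuous_comp; last exact: continuous_cos.
    by apply: cvgD; [apply: cvgM; [exact: cvg_cst|exact: cvg_id]|exact: cvg_cst].
  by rewrite mul1r (le_trans (cos_max _))//; have := sqr_ge0 z; lra.
have d1 (x z : R) : is_derive x (1 : R) (fun x : R => cos (x * z + t)) (- (z * sin (x * z + t))).
  apply: is_derive_eq.
  by rewrite /GRing.scale /=; ring.
have dC (x : R) : is_derive x (1 : R) C (- x * C x).
  have Ix : `]x - 1, x + 1[%classic x by rewrite /= in_itv/=; lra.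
  have df (y z : R) : (`]x - 1, x + 1[%classic y) -> [set: R] z -> derivable (fun x : R => cos (x * z + t)) y 1.
    by move=> _ _; have [] := d1 y z.
  have G_ub (y z : R) : (`]x - 1, x + 1[%classic y) -> [set: R] z ->
     `|partial1of2 (fun x z : R => cos (x * z + t)) y z| <= `|z|.
    move=> _ _; rewrite partial1of2E derive_val normrN normrM.
    by rewrite ler_piMr// sin_max.
  have H1 := @derivable_under_integral R _ _ gamma (fun x z : R => cos (x * z + t)) setT measurableT
    x _ _ Ix (fun y _ => ic y) df _ (fun y => normr_ge0 y) iz G_ub.
  have H2 := @differentiation_under_integral R _ _ gamma (fun x z : R => cos (x * z + t)) setT measurableT
    x _ _ Ix (fun y _ => ic y) df _ (fun y => normr_ge0 y) iz G_ub.
  apply: DeriveDef; first exact: H1.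
  rewrite -derive1E [LHS]H2 mulNr -stein_sin.
  rewrite -mulN1r -RintegralZl//; last first.
    apply: (@integrable_normal_prob R _ 1) => // [|z].
      apply: continuous_measurable_fun => z; apply: cvgM; first exact: cvg_id.
      apply: continuous_comp; last exact: continuous_sin.
      by apply: cvgD; [apply: cvgM; [exact: cvg_cst|exact: cvg_id]|exact: cvg_cst].
    by rewrite mul1r normrM (le_trans _ (normr_le_sqr z))// ler_piMr// sin_max.
  by apply: eq_Rintegral => z _; rewrite partial1of2E derive_val mulN1r.
(* The integrating factor $e^{x^2/2}$ turns the differential equation into a vanishing
   derivative. *)
have K (x : R) : is_derive x (1 : R) (fun x : R => C x * expR (x ^+ 2 / 2)) 0.
  have dCx := dC x.
  apply: is_derive_eq.
  by rewrite /GRing.scale /=; field.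
have := @is_derive_0_is_cst R (fun x : R => C x * expR (x ^+ 2 / 2)) s 0 K.
rewrite expr0n/= mul0r expR0 mulr1.
have -> : C 0 = cos t.
  rewrite /C; under eq_Rintegral do rewrite mul0r add0r.
  exact: (Rintegral_cst_probability (normal_prob 0 1) (cos t)).
by move=> <-; rewrite mulNr expRN mulfK// gt_eqF// expR_gt0.
Qed.

Lemma integral_sqr_normal_prob : \int[gamma]_z (z ^+ 2) = 1.
Proof.
transitivity (\int[gamma]_z (cst 1 z)); last first.
  exact: (Rintegral_cst_probability (normal_prob 0 1)).
apply/esym; apply: (@stein_identity R id (cst 1) 1).
- by move=> z; exact: cvg_cst.
- by move=> z; rewrite mul1r lerDr.
- by move=> z; rewrite normr1.
Qed.

Lemma integral_id_normal_prob : \int[gamma]_z z = 0.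
Proof.
transitivity (\int[gamma]_z (cst 0 z)); last first.
  exact: (Rintegral_cst_probability (normal_prob 0 1)).
transitivity (\int[gamma]_z (z * cst 1 z)).
  by apply: eq_Rintegral => z _; rewrite mulr1.
apply/esym; apply: (@stein_identity R (cst 1) (cst 0) 1).
- by move=> z; exact: cvg_cst.
- by move=> z; rewrite normr1 mul1r lerDl.
- by move=> z; rewrite normr0.
Qed.

End characteristic_function.

(** * Centered Gaussian variables and spaces *)

Section transfer.
Context d1 d2 d3 (T1 : measurableType d1) (T2 : measurableType d2)
  (Y : measurableType d3) (R : realType).
Context (P1 : probability T1 R) (P2 : probability T2 R).

(** Both sides integrate [f] against the common image law. It transports moments from the standard
    normal law, and later from a product measure. *)
Lemma Rintegral_same_law (X1 : T1 -> Y) (X2 : T2 -> Y) (f : Y -> R) :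
  measurable_fun setT X1 -> measurable_fun setT X2 -> measurable_fun setT f ->
  (forall B, measurable B -> P1 (X1 @^-1` B) = P2 (X2 @^-1` B)) ->
  P2.-integrable setT (EFin \o (f \o X2)) ->
  P1.-integrable setT (EFin \o (f \o X1)) /\
  \int[P1]_w f (X1 w) = \int[P2]_w f (X2 w).
Proof.
move=> mX1 mX2 mf law i2.
pose X1' : {mfun T1 >-> Y} := HB.pack X1 (isMeasurableFun.Build _ _ _ _ _ mX1).
pose X2' : {mfun T2 >-> Y} := HB.pack X2 (isMeasurableFun.Build _ _ _ _ _ mX2).
have E (g : Y -> \bar R) : (\int[pushforward P1 X1']_y g y = \int[pushforward P2 X2']_y g y)%E.
  by apply: eq_measure_integral => A mA _; exact: law.
have mEf : measurable_fun setT (EFin \o f) by exact/measurable_EFinP.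
have i1 : P1.-integrable setT (EFin \o (f \o X1)).
  apply/integrableP; split; first by apply/measurable_EFinP; exact: measurableT_comp.
  move/integrableP : i2 => [_]; apply: le_lt_trans.
  have mabs : measurable_fun setT (abse \o (EFin \o f)) by exact: measurableT_comp.
  have := E (abse \o (EFin \o f)).
  by rewrite !ge0_integral_pushforward//= => ->.
split => //; rewrite /Rintegral; congr fine.
have := E (EFin \o f).
by rewrite !integral_pushforward.
Qed.

End transfer.

Section gaussian_variable.
Context d (T : measurableType d) (R : realType) (P : probability T R).
Local Notation gamma := (normal_prob (0 : R) 1).

(** For [s = 0] the affine map is constant, so the preimage is everything or nothing, as the Dirac
    mass demands. *)
Lemma normal_law_affine (m s : R) (B : set R) : 0 <= s -> measurable B ->
  normal_law m s B = gamma (affine m s @^-1` B).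
Proof.
move=> s0 mB; rewrite /normal_law; case: eqVneq => [->|sN0]; last first.
  by rewrite normal_prob_affine// lt_neqAle eq_sym sN0.
rewrite diracE; have [Bm|nBm] := boolP (m \in B).
  rewrite (_ : _ @^-1` _ = setT); first by rewrite [RHS]probability_setT.
  by apply/seteqP; split => // z _; rewrite /affine /= mul0r addr0; exact: set_mem.
rewrite (_ : _ @^-1` _ = set0); first by rewrite measure0.
apply/seteqP; split => // z; rewrite /affine /= mul0r addr0 => Bm.
by move/negP : nBm; apply; exact: mem_set.
Qed.

(** Phrased with the affine image of the standard law, which varies continuously with [s] down to
    [s = 0]. *)
Definition centered_normal (X : T -> R) (s : R) :=
  [/\ measurable_fun setT X, 0 <= s & forall B : set R, measurable B ->
    P (X @^-1` B) = gamma (affine 0 s @^-1` B)].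

Lemma centered_normal_variable X s : centered_normal X s -> normal_variable P X.
Proof.
move=> [mX s0 law]; split => //; exists 0, s; split => // B mB.
by rewrite law// normal_law_affine.
Qed.

Lemma Rintegral_affine_normal (X : T -> R) (m s : R) (f : R -> R) :
  measurable_fun setT X -> measurable_fun setT f ->
  (forall B : set R, measurable B -> P (X @^-1` B) = gamma (affine m s @^-1` B)) ->
  gamma.-integrable setT (fun z => (f (m + s * z))%:E) ->
  P.-integrable setT (EFin \o (f \o X)) /\
  \int[P]_w f (X w) = \int[gamma]_z f (m + s * z).
Proof.
move=> mX mf law i2.
exact: (@Rintegral_same_law _ _ _ T (measurableTypeR R) (measurableTypeR R) R P
  (normal_prob 0 1) X (affine m s) f mX (@measurable_affine R m s) mf law i2).
Qed.

(** The mean equals the parameter [m], so a vanishing mean forces [m = 0]. Integrability stands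
    outside the implication because it is what allows the mean of a linear combination to be
    computed in the first place. *)
Lemma normal_variable_centered (X : T -> R) : normal_variable P X ->
  P.-integrable setT (EFin \o X) /\
  (\int[P]_w X w = 0 -> exists s, centered_normal X s).
Proof.
move=> [mX [m [s [s0 law]]]].
have law' (B : set R) : measurable B -> P (X @^-1` B) = gamma (affine m s @^-1` B).
  by move=> mB; rewrite law// normal_law_affine.
have iid : gamma.-integrable setT (fun z => z%:E).
  by apply: (@integrable_normal_prob R id 1) => // z; rewrite mul1r normr_le_sqr.
have isz : gamma.-integrable setT (fun z => (s * z)%:E).
  exact: (integrableZl measurableT s iid).
have im : gamma.-integrable setT (fun z : R => m%:E).
  exact: finite_measure_integrable_cst.
have [] := @Rintegral_affine_normal X m s id mX (@measurable_id _ _ _) law'.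
  exact: (integrableD measurableT im isz).
move=> iX /= ->; split => //.
rewrite RintegralD// RintegralZl// integral_id_normal_prob mulr0 addr0.
rewrite [X in X = _ -> _](_ : _ = m); last exact: (Rintegral_cst_probability (normal_prob 0 1)).
by move=> m0; exists s; split => //; move: law'; rewrite m0.
Qed.

Lemma centered_normal_sqr X s : centered_normal X s ->
  P.-integrable setT (fun w => (X w ^+ 2)%:E) /\ \int[P]_w (X w ^+ 2) = s ^+ 2.
Proof.
move=> [mX s0 law].
have isz : gamma.-integrable setT (fun z : R => (s ^+ 2 * z ^+ 2)%:E).
  exact: (integrableZl measurableT (s ^+ 2) (integrable_sqr_normal_prob R)).
have [] := @Rintegral_affine_normal X 0 s (fun x => x ^+ 2) mX _ law.
- exact: measurable_funX.
- by under eq_fun do rewrite add0r exprMn.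
move=> iX ->; split => //.
under eq_Rintegral do rewrite add0r exprMn.
rewrite RintegralZl ?integral_sqr_normal_prob ?mulr1//.
exact: integrable_sqr_normal_prob.
Qed.

Lemma centered_normal_cos X s (t u : R) : centered_normal X s ->
  \int[P]_w cos (t * X w + u) = cos u * expR (- (t * s) ^+ 2 / 2).
Proof.
move=> [mX s0 law].
have cc : continuous (fun x : R => cos (t * x + u)).
  move=> z; apply: continuous_comp; last exact: continuous_cos.
  by apply: cvgD; [apply: cvgM; [exact: cvg_cst|exact: cvg_id]|exact: cvg_cst].
have mc : measurable_fun setT (fun x : R => cos (t * x + u)) by exact: continuous_measurable_fun.
have [] := @Rintegral_affine_normal X 0 s _ mX mc law.
  apply: (@integrable_normal_prob R (fun z => cos (t * (0 + s * z) + u)) 1) => [|z].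
    by apply: (measurableT_comp mc); exact: measurable_affine.
  by rewrite mul1r (le_trans (cos_max _))//; have := sqr_ge0 z; lra.
by move=> _ ->; under eq_Rintegral do rewrite add0r mulrA; rewrite integral_cos_normal_prob.
Qed.

Lemma centered_normal_sin X s (t : R) : centered_normal X s ->
  \int[P]_w sin (t * X w) = 0.
Proof.
move=> cX; under eq_Rintegral do rewrite -cosBpihalf.
by rewrite (centered_normal_cos t (- (pi / 2)) cX) cosN cos_pihalf mul0r.
Qed.

End gaussian_variable.

(** * Pointwise limits of centered Gaussian variables *)

Section gaussian_limit.
Context d (T : measurableType d) (R : realType) (P : probability T R).
Local Notation gamma := (normal_prob (0 : R) 1).

Lemma Rintegral_indicator d' (T' : measurableType d') (Q : probability T' R)
  (A : set T') : measurable A -> \int[Q]_w (\1_A w) = fine (Q A).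
Proof. by move=> mA; rewrite /Rintegral integral_indic// setIT. Qed.

(** Approximates the indicator of $[c, \infty)$ from above, rising from 0 to 1 on an interval of
    length $1/m$ that ends at $c$. Being continuous, it can be applied to a convergent sequence of
    variables, unlike the indicator. *)
Definition ramp (c : R) (m : nat) (x : R) : R :=
  Num.max 0 (Num.min 1 (1 + m%:R * (x - c))).

Lemma continuous_ramp c m : continuous (ramp c m).
Proof.
move=> x; suff : {for x, continuous ((cst 0 : R^o -> R^o) \max
  ((cst 1 : R^o -> R^o) \min (fun y => 1 + m%:R * (y - c))))} by [].
apply: continuous_max; first exact: cvg_cst.
apply: continuous_min; first exact: cvg_cst.
apply: cvgD; first exact: cvg_cst.
apply: cvgM; first exact: cvg_cst.
by apply: cvgB; [exact: cvg_id|exact: cvg_cst].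
Qed.

Lemma normr_ramp_le1 c m x : `|ramp c m x| <= 1.
Proof.
rewrite ger0_norm /ramp; first by rewrite ge_max ler01 ge_min lexx.
by rewrite le_max lexx.
Qed.

Lemma cvg_ramp c x : ramp c m x @[m --> \oo] --> (\1_(`[c, +oo[%classic) x : R).
Proof.
rewrite indicE; have [cx|xc] := leP c x.
  rewrite mem_set /= ?in_itv/= ?cx//; apply: cvg_near_cst; apply: nearW => m.
  rewrite /ramp min_l ?max_r// lerDl mulr_ge0//; lra.
rewrite memNset /= ?in_itv/= ?andbT; last by apply/negP; rewrite -ltNge.
apply: cvg_near_cst; near=> m.
have : (c - x)^-1 <= m%:R by near: m; exact: nbhs_infty_ger.
rewrite -[_^-1]mul1r ler_pdivrMr; last lra.
move=> H; rewrite /ramp max_l// ge_min; apply/orP; right; nra.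
Unshelve. all: by end_near. Qed.

(* The limit of [E cos (t X_n) = exp (- (t s_n)^2 / 2)] is positive for some [t != 0],
   which makes the [s_n] converge; the law of the limit is then read off ramps. *)
Lemma cvg_centered_normal (X_ : (T -> R)^nat) (X : T -> R) (s_ : R^nat) :
  (forall n, centered_normal P (X_ n) (s_ n)) ->
  (forall w, X_ ^~ w @ \oo --> X w) ->
  exists2 s, centered_normal P X s & s_ n ^+ 2 @[n --> \oo] --> s ^+ 2.
Proof.
move=> cX XX.
have mX_ n : measurable_fun setT (X_ n) by have [] := cX n.
have mX : measurable_fun setT X by apply: measurable_fun_cvg mX_ _ => w _; exact: XX.
have mcos (Y : T -> R) (t : R) : measurable_fun setT Y ->
    measurable_fun setT (fun w => cos (t * Y w)).
  move=> mY; apply: (measurableT_comp (continuous_measurable_fun (@continuous_cos R))).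
  exact: measurable_funM.
pose Phi (t : R) := \int[P]_w cos (t * X w).
have cPhi t : expR (- (t * s_ n) ^+ 2 / 2) @[n --> \oo] --> Phi t.
  rewrite (_ : (fun n => _) = fun n => \int[P]_w cos (t * X_ n w)); last first.
    apply/funext => n; have := centered_normal_cos t 0 (cX n).
    by under eq_Rintegral do rewrite addr0; rewrite cos0 mul1r => ->.
  apply: (@cvg_Rintegral_bounded _ _ _ P setT _ _ 1) => //.
  - by move=> n; exact: mcos.
  - move=> w _; apply: continuous_cvg; first exact: continuous_cos.
    by apply: cvgM; [exact: cvg_cst|exact: XX].
  - by move=> n w _; exact: cos_max.
(* Continuity of $\Phi$ at 0 along one sequence. It excludes an escape of the [s_n] to infinity,
   which would make $\Phi$ vanish off 0. *)
have Phi_cvg : Phi (harmonic n) @[n --> \oo] --> (1 : R).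
  have -> : (1 : R) = \int[P]_w (cst 1 w).
    by rewrite Rintegral_cst_probability.
  apply: (@cvg_Rintegral_bounded _ _ _ P setT (fun n w => cos (harmonic n * X w)) _ 1) => //.
  - by move=> n; exact: mcos.
  - move=> w _ /=.
    have : cos (harmonic n * X w) @[n --> \oo] --> cos (0 * X w).
      apply: continuous_cvg; first exact: continuous_cos.
      by apply: cvgM; [exact: cvg_harmonic|exact: cvg_cst].
    by rewrite mul0r cos0.
  - by move=> n w _; exact: cos_max.
have [t t0 Pt] : exists2 t : R, t != 0 & 0 < Phi t.
  have /cvgr_gt /(_ 0 ltr01) [N _ /(_ N (leqnn _)) H] := Phi_cvg.
  by exists (harmonic N) => //; rewrite /harmonic /= gt_eqF// invr_gt0.
(* The solution $L = s^2$ of $\Phi(t) = e^{-t^2 s^2/2}$; positivity of $\Phi(t)$ makes the logarithm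
   continuous there. *)
pose L := - 2 * ln (Phi t) / t ^+ 2.
have t2 : t ^+ 2 != 0 by rewrite expf_neq0.
have sL : s_ n ^+ 2 @[n --> \oo] --> L.
  have -> : (fun n => s_ n ^+ 2) =
      (fun n => - 2 * ln (expR (- (t * s_ n) ^+ 2 / 2)) / t ^+ 2).
    by apply/funext => n; rewrite expRK; field.
  apply: cvgM; last exact: cvg_cst.
  apply: cvgM; first exact: cvg_cst.
  apply: (@continuous_cvg _ _ _ _ _ _ (@ln R)); last exact: cPhi.
  exact: continuous_ln.
have L0 : 0 <= L.
  by apply: (cvgr_to_ge sL); apply: nearW => n; exact: sqr_ge0.
have ss : s_ n @[n --> \oo] --> Num.sqrt L.
  rewrite (_ : s_ = fun n => Num.sqrt (s_ n ^+ 2)); last first.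
    by apply/funext => n; rewrite sqrtr_sqr ger0_norm//; have [] := cX n.
  by apply: continuous_cvg sL; exact: sqrt_continuous.
exists (Num.sqrt L); last by rewrite sqr_sqrtr.
split => //.
have ramp_eq c m : \int[P]_w ramp c m (X w) =
    \int[gamma]_z ramp c m (0 + Num.sqrt L * z).
  have mr : measurable_fun setT (ramp c m).
    by apply: continuous_measurable_fun; exact: continuous_ramp.
  have mrz (s : R) : measurable_fun setT (fun z => ramp c m (0 + s * z)).
    by apply: (measurableT_comp mr); exact: measurable_affine.
  have c1 : \int[P]_w ramp c m (X_ n w) @[n --> \oo] --> \int[P]_w ramp c m (X w).
    apply: (@cvg_Rintegral_bounded _ _ _ P setT _ _ 1) => //.
    - by move=> n; exact: measurableT_comp.
    - move=> w _; apply: continuous_cvg; first exact: continuous_ramp.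
      exact: XX.
    - by move=> n w _; exact: normr_ramp_le1.
  have c2 : \int[P]_w ramp c m (X_ n w) @[n --> \oo] -->
      \int[gamma]_z ramp c m (0 + Num.sqrt L * z).
    have step n : \int[P]_w ramp c m (X_ n w) = \int[gamma]_z ramp c m (0 + s_ n * z).
      have [m1 _ l1] := cX n.
      have [] // := Rintegral_affine_normal m1 mr l1.
      apply: (@integrable_normal_prob R _ 1) => // z.
      by rewrite mul1r (le_trans (normr_ramp_le1 _ _ _))//; have := sqr_ge0 z; lra.
    under eq_fun do rewrite step.
    apply: (@cvg_Rintegral_bounded _ _ _ (normal_prob (0 : R) 1) setT _ _ 1) => //.
    - by move=> n; exact: mrz.
    - move=> z _; apply: continuous_cvg; first exact: continuous_ramp.
      apply: cvgD; first exact: cvg_cst.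
      by apply: cvgM; [exact: ss|exact: cvg_cst].
    - by move=> n w _; exact: normr_ramp_le1.
  exact: (cvg_unique _ c1 c2).
move=> B mB.
pose X' : {mfun T >-> measurableTypeR R} := HB.pack X (isMeasurableFun.Build _ _ T (measurableTypeR R) X mX).
apply: (@probability_eq_rays R (distribution P X')
  (distribution (normal_prob (0 : R) 1) (affine 0 (Num.sqrt L))) _ B mB) => c.
rewrite /distribution /pushforward /=.
have mray (d' : measure_display) (T' : measurableType d') (Y : T' -> R) : measurable_fun setT Y ->
    measurable (Y @^-1` `[c, +oo[%classic).
  by move=> mY; rewrite -[X in measurable X]setTI; exact: mY.
have lim (d' : measure_display) (T' : measurableType d') (Q : probability T' R) (Y : T' -> R) : measurable_fun setT Y ->
    \int[Q]_w ramp c m (Y w) @[m --> \oo] --> fine (Q (Y @^-1` `[c, +oo[%classic)).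
  move=> mY; rewrite -Rintegral_indicator; last exact: mray.
  apply: (@cvg_Rintegral_bounded _ _ _ Q setT (fun m w => ramp c m (Y w)) _ 1) => //.
  - move=> m; apply: (measurableT_comp _ mY).
    by apply: continuous_measurable_fun; exact: continuous_ramp.
  - by move=> w _; exact: cvg_ramp.
  - by move=> n w _; exact: normr_ramp_le1.
have c1 := lim _ _ P X mX.
have c2 := lim _ _ (normal_prob (0 : R) 1) (affine 0 (Num.sqrt L)) (@measurable_affine R _ _).
rewrite -[LHS]fineK; last by rewrite fin_num_measure//; exact: mray.
rewrite -[RHS]fineK; last first.
  rewrite fin_num_measure//; apply: mray; exact: measurable_affine.
congr EFin; move: c1; rewrite (funext (ramp_eq c)) => c1.
exact: (cvg_unique _ c1 c2).
Unshelve. all: by end_near. Qed.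

End gaussian_limit.

(** * Linear spaces of centered Gaussian variables *)

Section gaussian_space.
Context d (T : measurableType d) (R : realType) (P : probability T R).
Implicit Types (V : set (T -> R)) (X Y Z : T -> R).

Definition subspace_pred V := V (cst 0) /\
  forall (a : R) X Y, V X -> V Y -> V (fun w => a * X w + Y w).

(** Linearity makes all finite families of members jointly Gaussian, so multivariate laws never have
    to be mentioned. *)
Definition gaussian_space V := subspace_pred V /\
  forall X, V X -> exists s, centered_normal P X s.

(** The covariance, since it is applied to centered variables. *)
Definition sprod X Y : R := \int[P]_w (X w * Y w).

Lemma sprodC X Y : sprod X Y = sprod Y X.
Proof. by apply: eq_Rintegral => w _; rewrite mulrC. Qed.

Lemma subspace_sum V n (c : 'I_n -> R) (X : 'I_n -> T -> R) : subspace_pred V ->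
  (forall i, V (X i)) -> V (fun w => \sum_(i < n) c i * X i w).
Proof.
move=> [V0 VD]; elim: n c X => [|n IH] c X VX.
  by under eq_fun do rewrite big_ord0.
under eq_fun do rewrite big_ord_recl.
by apply: VD => //; exact: IH.
Qed.

Section theory.
Variable V : set (T -> R).
Hypothesis gV : gaussian_space V.

Let VD a X Y : V X -> V Y -> V (fun w => a * X w + Y w).
Proof. by move: gV => [[_ H] _]; exact: H. Qed.

Lemma gaussian_space_add X Y : V X -> V Y -> V (fun w => X w + Y w).
Proof.
move=> VX VY; rewrite (_ : (fun w => _) = (fun w => 1 * X w + Y w)); first exact: VD.
by apply/funext => w; rewrite mul1r.
Qed.

Lemma gaussian_space_measurable X : V X -> measurable_fun setT X.
Proof. by case: gV => _ H /H[s []]. Qed.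

Lemma integrable_sprod X Y : V X -> V Y ->
  P.-integrable setT (fun w => (X w * Y w)%:E).
Proof.
move=> VX VY.
have [[sX /centered_normal_sqr[iX _]] [sY /centered_normal_sqr[iY _]]] :=
  ((proj2 gV) _ VX, (proj2 gV) _ VY).
have [mX mY] := (gaussian_space_measurable VX, gaussian_space_measurable VY).
apply: (le_integrable measurableT _ _ (integrableD measurableT iX iY)).
  by apply/measurable_EFinP; exact: measurable_funM.
move=> w _ /=; rewrite lee_fin normrM [leRHS]ger0_norm ?addr_ge0 ?sqr_ge0//.
rewrite -[X w ^+ 2]real_normK ?num_real// -[Y w ^+ 2]real_normK ?num_real//.
by have := sqr_ge0 (`|X w| - `|Y w|); rewrite sqrrB;
  have := sqr_ge0 `|X w|; have := sqr_ge0 `|Y w|; lra.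
Qed.

Lemma sprodDl a X Y Z : V X -> V Y -> V Z ->
  sprod (fun w => a * X w + Y w) Z = a * sprod X Z + sprod Y Z.
Proof.
move=> VX VY VZ; rewrite /sprod.
have [iX iY] := (integrable_sprod VX VZ, integrable_sprod VY VZ).
rewrite -RintegralZl// -RintegralD//; last first.
  by have := integrableZl measurableT a iX.
by apply: eq_Rintegral => w _; ring.
Qed.

Lemma sprodDr a X Y Z : V X -> V Y -> V Z ->
  sprod Z (fun w => a * X w + Y w) = a * sprod Z X + sprod Z Y.
Proof. by move=> VX VY VZ; rewrite sprodC sprodDl// ![sprod Z _]sprodC. Qed.

Lemma sprod0l Z : sprod (cst 0) Z = 0.
Proof.
rewrite /sprod; under eq_Rintegral do rewrite mul0r.
exact: (Rintegral_cst_probability P 0).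
Qed.

Lemma gaussian_space_sd X : V X -> exists2 s, centered_normal P X s & s ^+ 2 = sprod X X.
Proof.
by move=> VX; have [s cX] := (proj2 gV) _ VX; exists s => //;
  have [_ <-] := centered_normal_sqr cX.
Qed.

Lemma gaussian_space_cos X : V X ->
  \int[P]_w cos (X w) = expR (- sprod X X / 2).
Proof.
move=> /gaussian_space_sd [s cX <-].
have := centered_normal_cos 1 0 cX; rewrite cos0 !mul1r => <-.
by apply: eq_Rintegral => w _; rewrite addr0 mul1r.
Qed.

Lemma gaussian_space_sin X : V X -> \int[P]_w sin (X w) = 0.
Proof.
move=> /gaussian_space_sd [s cX _]; rewrite -(centered_normal_sin 1 cX).
by apply: eq_Rintegral => w _; rewrite mul1r.
Qed.

(** Reduces covariances to variances, which [cvg_centered_normal] controls. *)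
Lemma sprod_polarization X Y : V X -> V Y ->
  sprod X Y = (sprod (fun w => X w + Y w) (fun w => X w + Y w)
               - sprod X X - sprod Y Y) / 2.
Proof.
move=> VX VY; rewrite (_ : (fun w => _) = (fun w => 1 * X w + Y w)); last first.
  by apply/funext => w; rewrite mul1r.
rewrite sprodDl ?sprodDr ?[sprod Y X]sprodC//; last exact: VD.
by field.
Qed.

(** [X] is not taken in [V], so that the lemma also shows the members of the limit closure to be
    Gaussian. *)
Lemma cvg_sprod_diag (X_ : (T -> R)^nat) X : (forall n, V (X_ n)) -> 
  (forall w, X_ ^~ w @ \oo --> X w) ->
  (exists s, centered_normal P X s) /\ sprod (X_ n) (X_ n) @[n --> \oo] --> sprod X X.
Proof.
move=> VX XX.
have /choice [s_ cs] : forall n, exists s, centered_normal P (X_ n) s /\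
    s ^+ 2 = sprod (X_ n) (X_ n).
  by move=> n; have [s cs es] := gaussian_space_sd (VX n); exists s.
have [s cX cvs] := cvg_centered_normal (fun n => proj1 (cs n)) XX.
split; first by exists s.
rewrite {2}/sprod; have [_ ->] := centered_normal_sqr cX.
by move: cvs; rewrite (_ : (fun n => s_ n ^+ 2) = (fun n => sprod (X_ n) (X_ n)))//;
  apply/funext => n; have [] := cs n.
Qed.

Lemma cvg_sprod (X_ Y_ : (T -> R)^nat) X Y :
  (forall n, V (X_ n)) -> (forall n, V (Y_ n)) -> V X -> V Y ->
  (forall w, X_ ^~ w @ \oo --> X w) -> (forall w, Y_ ^~ w @ \oo --> Y w) ->
  sprod (X_ n) (Y_ n) @[n --> \oo] --> sprod X Y.
Proof.
move=> VX_ VY_ VX VY XX YY; rewrite (sprod_polarization VX VY).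
rewrite (funext (fun n => sprod_polarization (VX_ n) (VY_ n))).
apply: cvgM; last exact: cvg_cst.
apply: cvgB; last by have [] := cvg_sprod_diag VY_ YY.
apply: cvgB; last by have [] := cvg_sprod_diag VX_ XX.
have [|w|] // := @cvg_sprod_diag (fun n w => X_ n w + Y_ n w) (fun w => X w + Y w).
- by move=> n; exact: gaussian_space_add.
- by apply: cvgD.
Qed.

Lemma gaussian_space_field (E : Type) (D : set E) (X : E -> T -> R) :
  (forall x, D x -> V (X x)) -> gaussian_field P D X.
Proof.
move=> VX; split => [x Dx|n x Dx c]; first exact: gaussian_space_measurable (VX _ Dx).
have [|s] := (proj2 gV) (fun w => \sum_(i < n) c i * X (x i) w).
  by apply: subspace_sum => [|i]; [exact: (proj1 gV)|exact: VX].
exact: centered_normal_variable.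
Qed.

(** Limits hold at every [w], so null sets do not enter. One closure step suffices, each operator
    value being directly a limit of finite combinations. *)
Definition limit_closure : set (T -> R) :=
  [set X | exists2 X_ : (T -> R)^nat, forall n, V (X_ n) & forall w, X_ ^~ w @ \oo --> X w].

Lemma sub_limit_closure : V `<=` limit_closure.
Proof. by move=> X VX; exists (fun _ => X) => // w; exact: cvg_cst. Qed.

Lemma gaussian_limit_closure : gaussian_space limit_closure.
Proof.
split; first split.
- by apply: sub_limit_closure; have [[]] := gV.
- move=> a X Y [X_ VX XX] [Y_ VY YY]; exists (fun n w => a * X_ n w + Y_ n w).
    by move=> n; exact: VD.
  by move=> w; apply: cvgD => //; apply: cvgM => //; exact: cvg_cst.
- by move=> X [X_ VX XX]; have [] := cvg_sprod_diag VX XX.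
Qed.

End theory.
End gaussian_space.

(** * Uncorrelated jointly Gaussian families are independent *)

Section bounded_functions.
Context d (T : measurableType d) (R : realType) (P : probability T R).
Implicit Types f g h p q : T -> R.

Definition bounded_measurable f :=
  measurable_fun setT f /\ exists M, forall w, `|f w| <= M.

Lemma bounded_measurable_integrable f : bounded_measurable f ->
  P.-integrable setT (EFin \o f).
Proof. by move=> [mf [M fM]]; apply: (bounded_integrable _ measurableT mf (fun w _ => fM w)). Qed.

Lemma bounded_measurable_cst (r : R) : bounded_measurable (cst r).
Proof. by split => //; exists `|r|. Qed.

Lemma bounded_measurable_lin (a : R) f g : bounded_measurable f ->
  bounded_measurable g -> bounded_measurable (fun w => a * f w + g w).
Proof.
move=> [mf [M fM]] [mg [N gN]]; split.
  by apply: measurable_funD => //; exact: measurable_funM.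
exists (`|a| * M + N) => w; rewrite (le_trans (ler_normD _ _))// lerD// normrM.
by rewrite ler_wpM2l.
Qed.

Lemma bounded_measurable_mul f g : bounded_measurable f ->
  bounded_measurable g -> bounded_measurable (fun w => f w * g w).
Proof.
move=> [mf [M fM]] [mg [N gN]]; split; first exact: measurable_funM.
by exists (M * N) => w; rewrite normrM ler_pM.
Qed.

Lemma bounded_measurable_indic (A : set T) : measurable A -> bounded_measurable \1_A.
Proof.
move=> mA; split; first exact: measurable_indic.
by exists 1 => w; rewrite indicE; case: (_ \in _); rewrite ?normr1 ?normr0.
Qed.

Lemma Rintegral_lin (a : R) f g : bounded_measurable f -> bounded_measurable g ->
  \int[P]_w (a * f w + g w) = a * \int[P]_w f w + \int[P]_w g w.
Proof.
move=> bf bg.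
have [jf jg] := (bounded_measurable_integrable bf, bounded_measurable_integrable bg).
rewrite RintegralD// ?RintegralZl//.
by have := integrableZl measurableT a jf.
Qed.

End bounded_functions.

Section newton_schulz.
Context (R : realType).

(* Iterating this cubic converges to the sign on [[-1, 1]]; so the sign is a bounded
   pointwise limit of polynomials, which replaces Weierstrass approximation. *)
Definition newton_schulz (s : R) : R := s * (3 - s ^+ 2) / 2.

Lemma newton_schulzN s : newton_schulz (- s) = - newton_schulz s.
Proof. by rewrite /newton_schulz sqrrN !mulNr. Qed.

Lemma newton_schulz_bound s : `|s| <= 1 -> `|newton_schulz s| <= 1.
Proof.
move=> s1; rewrite /newton_schulz !normrM (ger0_norm (_ : 0 <= 2^-1))// ?invr_ge0//.
have s2 : s ^+ 2 <= 1 by rewrite -real_normK ?num_real// exprn_ile1.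
rewrite (ger0_norm (_ : 0 <= 3 - s ^+ 2)); last lra.
rewrite -real_normK ?num_real// ler_pdivrMr// mul1r.
have := normr_ge0 s; move: `|s| s1 => x x1 x0.
(* The claim is $2 - 3x + x^3 \ge 0$, and 1 is a double root of this cubic. *)
have : 0 <= (1 - x) ^+ 2 * (2 + x) by rewrite mulr_ge0 ?sqr_ge0//; lra.
by rewrite (_ : _ * (2 + x) = 2 - x * (3 - x ^+ 2)) => [|]; [lra|ring].
Qed.

Lemma newton_schulz_iter_le s n : `|s| <= 1 -> `|iter n newton_schulz s| <= 1.
Proof. by move=> s1; elim: n => //= n; exact: newton_schulz_bound. Qed.

(** The iterates increase from [s], and one step multiplies the distance to 1 by $(1 - x)(2 + x)/2 =
    1 - x/2 - x^2/2$, which is at most $1 - s/2$ when $x \ge s$. *)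
Lemma newton_schulz_iter_pos s n : 0 < s -> s <= 1 ->
  [/\ s <= iter n newton_schulz s, iter n newton_schulz s <= 1 &
      1 - iter n newton_schulz s <= (1 - s / 2) ^+ n].
Proof.
move=> s0 s1; elim: n => [|n [IH1 IH2 IH3]] /=; first by rewrite expr0; split; lra.
move: (iter _ _ _) IH1 IH2 IH3 => x x1 x2 x3.
have e1 : newton_schulz x - x = x * (1 - x) * (1 + x) / 2.
  by rewrite /newton_schulz; field.
have e2 : 1 - newton_schulz x = (1 - x) * ((1 - x) * (2 + x) / 2).
  by rewrite /newton_schulz; field.
have q1 : 0 <= x * (1 - x) * (1 + x) / 2.
  by rewrite divr_ge0 ?mulr_ge0//; lra.
have q2 : 0 <= (1 - x) * (2 + x) / 2 by rewrite divr_ge0 ?mulr_ge0//; lra.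
split; first lra.
  by rewrite -subr_ge0 e2 mulr_ge0//; lra.
rewrite e2 exprSr ler_pM//; first lra.
nra.
Qed.

Lemma cvg_newton_schulz s : `|s| <= 1 ->
  iter n newton_schulz s @[n --> \oo] --> Num.sg s.
Proof.
have pos t : 0 < t -> t <= 1 -> iter n newton_schulz t @[n --> \oo] --> (1 : R).
  move=> t0 t1; rewrite -[X in _ --> X]subr0.
  rewrite (_ : (fun n => _) = (fun n => 1 - (1 - iter n newton_schulz t))); last first.
    by apply/funext => n; ring.
  apply: cvgB; first exact: cvg_cst.
  apply: (@squeeze_cvgr _ _ _ _ (cst 0) (fun n => (1 - t / 2) ^+ n)).
  - by apply: nearW => n; have [_ h1 h2] := newton_schulz_iter_pos n t0 t1; rewrite h2 /=; lra.
  - exact: cvg_cst.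
  - by apply: cvg_expr; rewrite ger0_norm; lra.
move=> s1; have [s0|s0|->] := ltrgt0P s.
- by rewrite gtr0_sg//; apply: pos => //; rewrite (le_trans (ler_norm _)).
- rewrite ltr0_sg//.
  have E n : iter n newton_schulz s = - iter n newton_schulz (- s).
    by elim: n => [|n /= ->]; rewrite ?opprK// newton_schulzN.
  under eq_fun do rewrite E.
  apply: cvgN; apply: pos; first by rewrite oppr_gt0.
  by rewrite (le_trans (ler_norm _))// normrN.
- rewrite sgr0; apply: cvg_near_cst; apply: nearW => n.
  by elim: n => //= n ->; rewrite /newton_schulz !mul0r.
Qed.

End newton_schulz.

(** * A multiplicative class theorem *)

Section multiplicative_class.
Context d (T : measurableType d) (R : realType) (P : probability T R).
Implicit Types f g p q : T -> R.
Variable A : set (T -> R).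
Hypothesis bA : forall f, A f -> bounded_measurable f.
Hypothesis A1 : A (cst 1).
Hypothesis AM : forall f g, A f -> A g -> A (fun w => f w * g w).
Variable h : T -> R.
Hypothesis bh : bounded_measurable h.

(* The multipliers form an algebra closed under bounded pointwise limits, hence the
   sets with a multiplier as indicator form a sigma-algebra outright, without a
   pi-lambda argument. *)
Definition annihilated : set (T -> R) := [set p | bounded_measurable p /\
  forall q, A q -> \int[P]_w (p w * q w * h w) = 0].

(** The annihilated functions form only a linear space; their multipliers are also closed under
    products. The original condition is recovered at the end by multiplying the constant 1. *)
Definition multiplier : set (T -> R) := [set g | bounded_measurable g /\
  forall p, annihilated p -> annihilated (fun w => p w * g w)].

Lemma annihilated_lin (a : R) p q : annihilated p -> annihilated q ->
  annihilated (fun w => a * p w + q w).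
Proof.
move=> [bp Hp] [bq Hq]; split; first exact: bounded_measurable_lin.
move=> g Ag; have bg := bA Ag.
transitivity (\int[P]_w (a * (p w * g w * h w) + q w * g w * h w)).
  by apply: eq_Rintegral => w _; ring.
rewrite Rintegral_lin ?Hp ?Hq ?mulr0 ?addr0//.
  by do 2 apply: bounded_measurable_mul => //.
by do 2 apply: bounded_measurable_mul => //.
Qed.

Lemma annihilated_cvg (p_ : (T -> R)^nat) p M : (forall n, annihilated (p_ n)) ->
  (forall n w, `|p_ n w| <= M) -> (forall w, p_ ^~ w @ \oo --> p w) -> annihilated p.
Proof.
move=> Ap pM pp.
have mp : measurable_fun setT p.
  by apply: (measurable_fun_cvg (fun n => proj1 (proj1 (Ap n)))) => w _; exact: pp.
have bp w : `|p w| <= M.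
  by apply: (cvgr_to_le (cvg_norm (pp w))); apply: nearW => n; exact: pM.
split; first by split => //; exists M.
move=> q Aq; have [mq [N qN]] := bA Aq; have [mh [K hK]] := bh.
have c : \int[P]_w (p_ n w * q w * h w) @[n --> \oo] --> \int[P]_w (p w * q w * h w).
  apply: (@cvg_Rintegral_bounded _ _ _ P setT _ _ (M * N * K)) => //.
  - move=> n; apply: measurable_funM => //; apply: measurable_funM => //.
    by have [[]] := Ap n.
  - move=> w _; apply: cvgM; last exact: cvg_cst.
    by apply: cvgM; [exact: pp|exact: cvg_cst].
  - by move=> n w _; rewrite !normrM !ler_pM ?mulr_ge0.
have c0 : \int[P]_w (p_ n w * q w * h w) @[n --> \oo] --> (0 : R).
  by apply: cvg_near_cst; apply: nearW => n; have [_ H] := Ap n; exact: H.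
exact: (cvg_unique _ c c0).
Qed.

(** Testing [p * g] against [q] is testing [p] against [g * q], which is again in [A]. *)
Lemma sub_multiplier : A `<=` multiplier.
Proof.
move=> g Ag; split; first exact: bA.
move=> p [bp Hp]; split; first by apply: bounded_measurable_mul => //; exact: bA.
move=> q Aq; rewrite -[RHS](Hp _ (AM Ag Aq)).
by apply: eq_Rintegral => w _; rewrite !mulrA.
Qed.

Lemma multiplier_lin (a : R) f g : multiplier f -> multiplier g ->
  multiplier (fun w => a * f w + g w).
Proof.
move=> [bf Hf] [bg Hg]; split; first exact: bounded_measurable_lin.
move=> p Ap.
rewrite (_ : (fun w => _) = (fun w => a * (p w * f w) + p w * g w)).
  by apply: annihilated_lin; [exact: Hf|exact: Hg].
by apply/funext => w; ring.
Qed.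

Lemma multiplier_mul f g : multiplier f -> multiplier g ->
  multiplier (fun w => f w * g w).
Proof.
move=> [bf Hf] [bg Hg]; split; first exact: bounded_measurable_mul.
move=> p Ap; rewrite (_ : (fun w => _) = (fun w => p w * f w * g w)).
  by apply: Hg; exact: Hf.
by apply/funext => w; ring.
Qed.

Lemma multiplier_cvg (f_ : (T -> R)^nat) f M : (forall n, multiplier (f_ n)) ->
  (forall n w, `|f_ n w| <= M) -> (forall w, f_ ^~ w @ \oo --> f w) -> multiplier f.
Proof.
move=> Mf fM ff.
have mf : measurable_fun setT f.
  by apply: (measurable_fun_cvg (fun n => proj1 (proj1 (Mf n)))) => w _; exact: ff.
split; first split => //.
  by exists M => w; apply: (cvgr_to_le (cvg_norm (ff w))); apply: nearW => n; exact: fM.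
move=> p Ap; have [[mp [N pN]] _] := Ap.
apply: (@annihilated_cvg (fun n w => p w * f_ n w) _ (N * M)).
- by move=> n; exact: (proj2 (Mf n)).
- by move=> n w; rewrite normrM ler_pM.
- by move=> w; apply: cvgM => //; exact: cvg_cst.
Qed.

Lemma multiplier_cst (r : R) : multiplier (cst r).
Proof.
have M1 := sub_multiplier A1.
have M0 : multiplier (fun w => -1 * cst 1 w + cst 1 w) by exact: multiplier_lin.
rewrite (_ : cst r = fun w => r * cst 1 w + (-1 * cst 1 w + cst 1 w)).
  exact: multiplier_lin.
by apply/funext => w /=; ring.
Qed.

Lemma multiplier_sg f : multiplier f -> multiplier (fun w => Num.sg (f w)).
Proof.
move=> Mf; have [[mf [M fM]] _] := Mf.
(* Dividing by [N] brings the values into $[-1, 1]$, where the iteration converges, without changing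
   the sign. *)
pose N := `|M| + 1; have N0 : 0 < N by rewrite /N; have := normr_ge0 M; lra.
have f1 w : `|N^-1 * f w| <= 1.
  rewrite normrM gtr0_norm ?invr_gt0// mulrC ler_pdivrMr// mul1r.
  by rewrite (le_trans (fM w))// /N; have := ler_norm M; lra.
have Mi n : multiplier (fun w => iter n (@newton_schulz R) (N^-1 * f w)).
  elim: n => [|n IH] /=.
    rewrite (_ : (fun w => _) = fun w => N^-1 * f w + cst 0 w).
      by apply: multiplier_lin => //; exact: multiplier_cst.
    by apply/funext => w; rewrite addr0.
  rewrite /newton_schulz; set s := fun w => iter n _ _ in IH.
  rewrite (_ : (fun w => _) = fun w => s w * ((- 2^-1) * (s w * s w) + cst (3 / 2) w)).
    apply: multiplier_mul => //; apply: multiplier_lin; first exact: multiplier_mul.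
    exact: multiplier_cst.
  by apply/funext => w; rewrite /s /=; field.
apply: (multiplier_cvg Mi (M := 1)).
  by move=> n w; exact: newton_schulz_iter_le.
move=> w; have := cvg_newton_schulz (f1 w).
by rewrite sgrM gtr0_sg ?invr_gt0// mul1r.
Qed.

Definition multiplier_set : set (set T) := [set B | multiplier \1_B].

Lemma multiplier_set_gt0 f : multiplier f -> multiplier_set [set w | 0 < f w].
Proof.
move=> /multiplier_sg Mf; rewrite /multiplier_set /=.
(* With $s$ the sign, $(s^2 + s)/2$ is 1 for $s = 1$ and 0 for $s = 0$ or $s = -1$. *)
rewrite (_ : \1__ = fun w => 2^-1 * (Num.sg (f w) * Num.sg (f w)) + (2^-1 * Num.sg (f w) + cst 0 w)).
  apply: multiplier_lin; first exact: multiplier_mul.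
  by apply: multiplier_lin => //; exact: multiplier_cst.
apply/funext => w; rewrite indicE /=.
have [f0|f0|f0] := ltrgt0P (f w).
- by rewrite mem_set//= gtr0_sg//; field.
- rewrite memNset/=; last by apply/negP; rewrite -leNgt ltW.
  by rewrite ltr0_sg//; field.
- by rewrite memNset/= f0 ?ltxx// sgr0; ring.
Qed.

Lemma multiplier_setU B C : multiplier_set B -> multiplier_set C ->
  multiplier_set (B `|` C).
Proof.
move=> MB MC; rewrite /multiplier_set /=.
rewrite (_ : \1__ = fun w => -1 * (\1_B w * \1_C w) + (1 * \1_B w + \1_C w)).
  apply: multiplier_lin; first exact: multiplier_mul.
  exact: multiplier_lin.
apply/funext => w; rewrite !indicE in_setU.
by case: (w \in B); case: (w \in C) => /=; ring.
Qed.

Lemma multiplier_set_sigma : sigma_algebra setT multiplier_set.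
Proof.
have M0 : multiplier_set set0.
  by rewrite /multiplier_set /= indic0; exact: multiplier_cst.
split => //.
- move=> B MB; rewrite /multiplier_set /=.
  rewrite (_ : \1__ = fun w => -1 * \1_B w + cst 1 w).
    by apply: multiplier_lin => //; exact: multiplier_cst.
  apply/funext => w; rewrite !indicE in_setD in_setT /=.
  by case: (w \in B) => /=; ring.
- move=> B MB; pose C n := \big[setU/set0]_(i < n) B i.
  have MC n : multiplier_set (C n).
    by rewrite /C; elim: n => [|n IH]; rewrite ?big_ord0// big_ord_recr; exact: multiplier_setU.
  apply: (multiplier_cvg MC (M := 1)).
    by move=> n w; rewrite indicE; case: (_ \in _); rewrite ?normr1 ?normr0.
  move=> w; apply: cvg_near_cst; rewrite indicE.
  have [[i _ Bi]|nB] := pselect ((\bigcup_k B k) w).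
    near=> n; rewrite indicE !mem_set//; first by exists i.
    rewrite /C -bigcup_mkord; exists i => //=; near: n; exact: nbhs_infty_gt.
  apply: nearW => n; rewrite indicE !memNset// /C -bigcup_mkord => -[i _ Bi].
  by apply: nB; exists i.
Unshelve. all: by end_near. Qed.

(** The [f_ n] have no common bound and [Y] may be unbounded, so [multiplier_cvg] does not apply.
    Instead [T] is retyped with the multiplier sets as its measurable sets, and measurability passes
    to pointwise limits. *)
Lemma multiplier_set_preimage (f_ : (T -> R)^nat) (Y : T -> R) :
  (forall n, multiplier (f_ n)) -> (forall w, f_ ^~ w @ \oo --> Y w) ->
  forall B : set R, measurable B -> multiplier_set (Y @^-1` B).
Proof.
move=> Mf fY B mB.
pose T' := g_sigma_algebraType multiplier_set.
have mS (C : set T') : measurable C <-> multiplier_set C.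
  rewrite /measurable /= sigma_algebra_id//; exact: multiplier_set_sigma.
have mf n : measurable_fun (setT : set T') (f_ n : T' -> R).
  apply: (measurability _ (RGenOInfty.measurableE R)) => _ [_ [c ->] <-].
  rewrite setTI; apply/mS.
  rewrite (_ : _ @^-1` _ = [set w | 0 < 1 * f_ n w + cst (- c) w]).
    apply: multiplier_set_gt0; apply: multiplier_lin => //; exact: multiplier_cst.
  by apply/seteqP; split => w /=; rewrite in_itv/= andbT mul1r subr_gt0.
have mY : measurable_fun (setT : set T') (Y : T' -> R).
  by apply: (measurable_fun_cvg mf) => w _; exact: fY.
by apply/mS; rewrite -[_ @^-1` _]setTI; exact: mY.
Qed.

(** The first hypothesis says that the constant 1 is annihilated; multiplying it by the indicator of
    a multiplier set gives the claim. Measurability of [B] comes along because multipliers are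
    measurable functions. *)
Lemma multiplicative_class (E : Type) (D : set E) (Y : E -> T -> R) :
  (forall q, A q -> \int[P]_w (q w * h w) = 0) ->
  (forall x, D x -> exists2 f_ : (T -> R)^nat, forall n, A (f_ n) &
     forall w, f_ ^~ w @ \oo --> Y x w) ->
  forall B, sigma_field D Y B -> measurable B /\ \int[P]_w (\1_B w * h w) = 0.
Proof.
move=> Ah AY B sB.
have : multiplier_set B.
  apply: (smallest_sub multiplier_set_sigma _ sB) => _ [x Dx [C mC <-]].
  rewrite setTI; have [f_ Af fY] := AY _ Dx.
  by apply: (multiplier_set_preimage _ fY) => // n; exact: sub_multiplier.
move=> [[mB _] /(_ (cst 1))[]].
  split; first exact: bounded_measurable_cst.
  by move=> q Aq; under eq_Rintegral do rewrite mul1r; exact: Ah.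
move=> _ /(_ _ A1) HB; split.
  rewrite (_ : B = \1_B @^-1` [set x : R | 0 < x]).
    rewrite -[X in measurable X]setTI; apply: mB => //.
    by rewrite -set_itvoy; exact: measurable_itv.
  apply/seteqP; split => w /=; rewrite indicE; first by move=> Bw; rewrite mem_set.
  by case: (boolP (w \in B)) => [/set_mem//|_]; rewrite ltxx.
by rewrite -[RHS]HB; apply: eq_Rintegral => w _; rewrite mul1r mulr1.
Qed.

End multiplicative_class.

Section trigonometric_polynomials.
Context d (T : measurableType d) (R : realType).
Variable W : set (T -> R).

(** The real form of the span of the exponentials $e^{iX}$; the addition formulas make it an algebra
    when [W] is linear. *)
Inductive trig_span : (T -> R) -> Prop :=
| trig_cos X : W X -> trig_span (fun w => cos (X w))
| trig_sin X : W X -> trig_span (fun w => sin (X w))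
| trig_lin (a : R) f g : trig_span f -> trig_span g -> trig_span (fun w => a * f w + g w).

Hypothesis sW : subspace_pred W.
Hypothesis mW : forall X, W X -> measurable_fun setT X.

Lemma bounded_measurable_trig f : trig_span f -> bounded_measurable f.
Proof.
elim=> [X WX|X WX|a {}f g _ bf _ bg]; last exact: bounded_measurable_lin.
- split; last by exists 1 => w; exact: cos_max.
  apply: (measurableT_comp _ (mW WX)).
  by apply: continuous_measurable_fun; exact: continuous_cos.
- split; last by exists 1 => w; exact: sin_max.
  apply: (measurableT_comp _ (mW WX)).
  by apply: continuous_measurable_fun; exact: continuous_sin.
Qed.

Lemma trig_span0 : trig_span (cst 0).
Proof.
rewrite (_ : cst 0 = fun w => sin ((cst 0 : T -> R) w)).
  by apply: trig_sin; have [] := sW.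
by apply/funext => w; rewrite sin0.
Qed.

Lemma trig_span1 : trig_span (cst 1).
Proof.
rewrite (_ : cst 1 = fun w => cos ((cst 0 : T -> R) w)).
  by apply: trig_cos; have [] := sW.
by apply/funext => w; rewrite cos0.
Qed.

Lemma trig_span_scale a f : trig_span f -> trig_span (fun w => a * f w).
Proof.
move=> tf; rewrite (_ : (fun w => _) = fun w => a * f w + cst 0 w).
  by apply: trig_lin => //; exact: trig_span0.
by apply/funext => w; rewrite addr0.
Qed.

Let WD X Y : W X -> W Y -> W (fun w => X w + Y w).
Proof.
move=> WX WY; rewrite (_ : (fun w => _) = fun w => 1 * X w + Y w).
  by have [_] := sW; apply.
by apply/funext => w; rewrite mul1r.
Qed.

Let WB X Y : W X -> W Y -> W (fun w => X w - Y w).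
Proof.
move=> WX WY; rewrite (_ : (fun w => _) = fun w => -1 * Y w + X w).
  by have [_] := sW; apply.
by apply/funext => w; rewrite mulN1r addrC.
Qed.

Lemma trig_span_mul f g : trig_span f -> trig_span g -> trig_span (fun w => f w * g w).
Proof.
move=> tf; elim: tf g => [X WX|X WX|a {}f f' _ IHf _ IHf'] g tg; last first.
  rewrite (_ : (fun w => _) = fun w => a * (f w * g w) + f' w * g w).
    by apply: trig_lin; [exact: IHf|exact: IHf'].
  by apply/funext => w; ring.
(* [last first] has reversed the goals: the sine of [X] comes before the cosine, each against a
   cosine, a sine and a combination. *)
all: elim: tg => [Y WY|Y WY|a {}f g' _ IHf _ IHf'].
- rewrite (_ : (fun w => _) = fun w => 2^-1 * sin (X w + Y w) + 2^-1 * sin (X w - Y w)).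
    by apply: trig_lin; [|apply: trig_span_scale]; apply: trig_sin; [exact: WD|exact: WB].
  by apply/funext => w; rewrite sinD sinB; field.
- rewrite (_ : (fun w => _) = fun w => - 2^-1 * cos (X w + Y w) + 2^-1 * cos (X w - Y w)).
    by apply: trig_lin; [|apply: trig_span_scale]; apply: trig_cos; [exact: WD|exact: WB].
  by apply/funext => w; rewrite cosD cosB; field.
- rewrite (_ : (fun w => _) = fun w => a * (sin (X w) * f w) + sin (X w) * g' w).
    exact: trig_lin.
  by apply/funext => w; ring.
- rewrite (_ : (fun w => _) = fun w => 2^-1 * cos (X w + Y w) + 2^-1 * cos (X w - Y w)).
    by apply: trig_lin; [|apply: trig_span_scale]; apply: trig_cos; [exact: WD|exact: WB].
  by apply/funext => w; rewrite cosD cosB; field.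
- rewrite (_ : (fun w => _) = fun w => 2^-1 * sin (X w + Y w) + - 2^-1 * sin (X w - Y w)).
    by apply: trig_lin; [|apply: trig_span_scale]; apply: trig_sin; [exact: WD|exact: WB].
  by apply/funext => w; rewrite sinD sinB; field.
- rewrite (_ : (fun w => _) = fun w => a * (cos (X w) * f w) + cos (X w) * g' w).
    exact: trig_lin.
  by apply/funext => w; ring.
Qed.

(** This is the difference quotient of $y \mapsto \sin(yx)$ at 0. It recovers unbounded variables
    from the bounded functions in the span. *)
Lemma cvg_sin_harmonic (x : R) : (harmonic n)^-1 * sin (harmonic n * x) @[n --> \oo] --> x.
Proof.
have D : is_derive (0 : R) (1 : R) (fun y : R => sin (y * x)) x.
  apply: is_derive_eq.
  by rewrite /GRing.scale /= mul0r cos0; ring.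
have /cvg_ex [l Dl] : cvg (h^-1 *: (sin ((h *: 1 + 0 : R) * x) - sin (0 * x)) @[h --> 0^'] : set_system R).
  by have [] := D.
have lx : l = x by have [_ <-] := D; exact/esym/cvg_lim.
rewrite lx in Dl.
have /cvgr_dnbhsP /(_ (@harmonic R)) H := Dl.
rewrite (_ : (fun n => _) = fun n => (harmonic n)^-1 *: (sin ((harmonic n *: 1 + 0 : R) * x) - sin (0 * x))).
  by apply: H; split => [n|]; [rewrite /harmonic /= gt_eqF// invr_gt0|exact: cvg_harmonic].
by apply/funext => n; rewrite /GRing.scale /= mulr1 addr0 mul0r sin0 subr0.
Qed.

Lemma trig_span_cvg X : W X -> exists2 f_ : (T -> R)^nat,
  forall n, trig_span (f_ n) & forall w, f_ ^~ w @ \oo --> X w.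
Proof.
move=> WX; exists (fun n w => (harmonic n)^-1 * sin (harmonic n * X w)).
  move=> n; apply: trig_span_scale; apply: (@trig_sin (fun w => harmonic n * X w)).
  rewrite (_ : (fun w => _) = fun w => harmonic n * X w + cst 0 w).
    by have [W0 WL] := sW; exact: WL.
  by apply/funext => w; rewrite addr0.
by move=> w; exact: cvg_sin_harmonic.
Qed.

End trigonometric_polynomials.

Section independence.
Context d (T : measurableType d) (R : realType) (P : probability T R).
Variables (V W1 W2 : set (T -> R)).
Hypothesis gV : gaussian_space P V.
Hypotheses (sW1 : subspace_pred W1) (sW2 : subspace_pred W2).
Hypotheses (W1V : W1 `<=` V) (W2V : W2 `<=` V).
Hypothesis W12 : forall X Y, W1 X -> W2 Y -> sprod P X Y = 0.

Let mV X : V X -> measurable_fun setT X.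
Proof. exact: (gaussian_space_measurable gV). Qed.

Let VB X Y : V X -> V Y -> V (fun w => -1 * Y w + X w).
Proof. by move=> VX VY; have [[_ VL] _] := gV; exact: VL. Qed.

Let bm1 f : trig_span W1 f -> bounded_measurable f.
Proof. by apply: bounded_measurable_trig => // X /W1V; exact: mV. Qed.

Let bm2 f : trig_span W2 f -> bounded_measurable f.
Proof. by apply: bounded_measurable_trig => // X /W2V; exact: mV. Qed.

Let bmc X : V X -> bounded_measurable (fun w => cos (X w)).
Proof. by move=> VX; apply: (@bounded_measurable_trig _ _ _ V) => //; exact: trig_cos. Qed.

Let bms X : V X -> bounded_measurable (fun w => sin (X w)).
Proof. by move=> VX; apply: (@bounded_measurable_trig _ _ _ V) => //; exact: trig_sin. Qed.

(** Without the cross term, $X + Y$ and $X - Y$ both have variance $E X^2 + E Y^2$, and the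
    exponential factorizes. *)
Let sumV X Y : V X -> V Y -> sprod P X Y = 0 ->
  [/\ V (fun w => X w + Y w), V (fun w => -1 * Y w + X w),
   \int[P]_w cos (X w + Y w) = (\int[P]_w cos (X w)) * (\int[P]_w cos (Y w)) &
   \int[P]_w cos (-1 * Y w + X w) = (\int[P]_w cos (X w)) * (\int[P]_w cos (Y w))].
Proof.
move=> VX VY XY; have VA := gaussian_space_add gV VX VY; have VS := VB VX VY.
split => //; rewrite !(gaussian_space_cos gV)// -expRD; congr expR.
  rewrite (sprod_polarization gV VX VY) in XY; lra.
rewrite !(sprodDl gV)// !(sprodDr gV)// [sprod P Y X]sprodC XY; lra.
Qed.

Let Rintegral_lin2 (a b : R) f g : bounded_measurable f -> bounded_measurable g ->
  \int[P]_w (a * f w + b * g w) = a * \int[P]_w f w + b * \int[P]_w g w.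
Proof.
move=> bf bg; rewrite (Rintegral_lin P a bf)// ?RintegralZl//.
  exact: (bounded_measurable_integrable P bg).
rewrite (_ : (fun w => _) = fun w => b * g w + cst 0 w).
  by apply: bounded_measurable_lin => //; exact: bounded_measurable_cst.
by apply/funext => w; rewrite addr0.
Qed.

(** By bilinearity only single sines and cosines matter. The product formulas leave integrals of
    sines, which vanish, and of cosines of $X \pm Y$, which are equal: they add up for two cosines
    and cancel for two sines. *)
Lemma trig_span_uncorrelated f g : trig_span W1 f -> trig_span W2 g ->
  \int[P]_w (f w * g w) = (\int[P]_w f w) * \int[P]_w g w.
Proof.
move=> tf; elim: tf g => [X WX|X WX|a {}f f' tf IHf tf' IHf'] g tg; last first.
  have [[bf bf'] bg] := (bm1 tf, bm1 tf', bm2 tg).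
  rewrite (Rintegral_lin P a bf bf') mulrDl -mulrA -IHf// -IHf'//.
  have [bfg bfg'] := (bounded_measurable_mul bf bg, bounded_measurable_mul bf' bg).
  by rewrite -(Rintegral_lin P a bfg bfg'); apply: eq_Rintegral => w _; ring.
all: elim: tg => [Y WY|Y WY|a {}f g' tf IHf tg' IHg'].
- have [VX VY] := (W1V WX, W2V WY); have [VA VS _ _] := sumV VX VY (W12 WX WY).
  transitivity (\int[P]_w (2^-1 * sin (X w + Y w) + 2^-1 * sin (-1 * Y w + X w))).
    by apply: eq_Rintegral => w _; rewrite mulN1r [- Y w + X w]addrC sinD sinB; field.
  by rewrite Rintegral_lin2 ?(gaussian_space_sin gV)//; [ring|exact: bms|exact: bms].
- have [VX VY] := (W1V WX, W2V WY); have [VA VS eA eS] := sumV VX VY (W12 WX WY).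
  transitivity (\int[P]_w (- 2^-1 * cos (X w + Y w) + 2^-1 * cos (-1 * Y w + X w))).
    by apply: eq_Rintegral => w _; rewrite mulN1r [- Y w + X w]addrC cosD cosB; field.
  rewrite Rintegral_lin2; [|exact: bmc|exact: bmc].
  by rewrite eA eS !(gaussian_space_sin gV)//; ring.
- have [[bf bg] bX] := (bm2 tf, bm2 tg', bms (W1V WX)).
  rewrite (Rintegral_lin P a bf bg) mulrDr mulrCA -IHf -IHg'.
  have [bfg bfg'] := (bounded_measurable_mul bX bf, bounded_measurable_mul bX bg).
  by rewrite -(Rintegral_lin P a bfg bfg'); apply: eq_Rintegral => w _; ring.
- have [VX VY] := (W1V WX, W2V WY); have [VA VS eA eS] := sumV VX VY (W12 WX WY).
  transitivity (\int[P]_w (2^-1 * cos (X w + Y w) + 2^-1 * cos (-1 * Y w + X w))).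
    by apply: eq_Rintegral => w _; rewrite mulN1r [- Y w + X w]addrC cosD cosB; field.
  rewrite Rintegral_lin2; [|exact: bmc|exact: bmc].
  by rewrite eA eS; field.
- have [VX VY] := (W1V WX, W2V WY); have [VA VS _ _] := sumV VX VY (W12 WX WY).
  transitivity (\int[P]_w (2^-1 * sin (X w + Y w) + - 2^-1 * sin (-1 * Y w + X w))).
    by apply: eq_Rintegral => w _; rewrite mulN1r [- Y w + X w]addrC sinD sinB; field.
  rewrite Rintegral_lin2; [|exact: bms|exact: bms].
  by rewrite !(gaussian_space_sin gV)//; ring.
- have [[bf bg] bX] := (bm2 tf, bm2 tg', bmc (W1V WX)).
  rewrite (Rintegral_lin P a bf bg) mulrDr mulrCA -IHf -IHg'.
  have [bfg bfg'] := (bounded_measurable_mul bX bf, bounded_measurable_mul bX bg).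
  by rewrite -(Rintegral_lin P a bfg bfg'); apply: eq_Rintegral => w _; ring.
Qed.

(** The multiplicative class theorem is applied to one side at a time: with [h] a centered
    trigonometric polynomial over [W2], to reach [\1_A]; then with [h] the centered [\1_A], to reach
    [\1_B]. *)
Lemma orthogonal_independent (E1 : Type) (D : set E1) (X Y : E1 -> T -> R) :
  (forall x, D x -> W1 (X x)) -> (forall x, D x -> W2 (Y x)) ->
  independent_fields P D X Y.
Proof.
move=> XW YW A B sA sB.
have bcst (r : R) : bounded_measurable (cst r : T -> R) by exact: bounded_measurable_cst.
have bB (g : T -> R) (r : R) : bounded_measurable g -> bounded_measurable (fun w => g w - r).
  move=> bg; rewrite (_ : (fun w => _) = fun w => 1 * g w + cst (- r) w).
    exact: (bounded_measurable_lin 1 bg (bcst (- r))).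
  by apply/funext => w; rewrite mul1r.
have RB (f g : T -> R) (r : R) : bounded_measurable f -> bounded_measurable g ->
    \int[P]_w (f w * (g w - r)) = \int[P]_w (f w * g w) - r * \int[P]_w f w.
  move=> bf bg; have bfg := bounded_measurable_mul bf bg.
  transitivity (\int[P]_w (1 * (f w * g w) + (- r) * f w)).
    by apply: eq_Rintegral => w _; ring.
  by rewrite Rintegral_lin2//; ring.
have mc1 := multiplicative_class (P := P) bm1 (trig_span1 sW1) (trig_span_mul sW1).
have mc2 := multiplicative_class (P := P) bm2 (trig_span1 sW2) (trig_span_mul sW2).
have H1 g : trig_span W2 g -> measurable A /\
    \int[P]_w (\1_A w * g w) = fine (P A) * \int[P]_w g w.
  move=> tg; have bg := bm2 tg.
  have [||mA HA] := mc1 _ (bB g (\int[P]_w g w) bg) _ D X _ _ A sA.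
  - move=> q tq; rewrite RB//; last exact: bm1.
    by rewrite trig_span_uncorrelated//; ring.
  - by move=> x Dx; apply: trig_span_cvg => //; exact: XW.
  split => //; move: HA; rewrite RB//; last exact: bounded_measurable_indic.
  by rewrite Rintegral_indicator//; lra.
have [mA _] := H1 _ (trig_span1 sW2).
have bA := bounded_measurable_indic R mA.
have [||mB] := mc2 _ (bB _ (fine (P A)) bA) _ D Y _ _ B sB.
- move=> q tq; rewrite RB//; last exact: bm2.
  have [_ H] := H1 _ tq.
  by under eq_Rintegral do rewrite mulrC; rewrite H; ring.
- by move=> x Dx; apply: trig_span_cvg => //; exact: YW.
have bBi := bounded_measurable_indic R mB.
rewrite RB// Rintegral_indicator// => HB.
have : \int[P]_w (\1_(A `&` B) w) = fine (P A) * fine (P B).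
  move/eqP : HB; rewrite subr_eq0 => /eqP <-.
  by apply: eq_Rintegral => w _; rewrite indicI mulrC.
rewrite Rintegral_indicator; last exact: measurableI.
move=> HI; rewrite -[LHS]fineK ?fin_num_measure//; last exact: measurableI.
by rewrite HI EFinM !fineK// fin_num_measure.
Qed.

End independence.

(** * Independence implies vanishing covariance *)

Section independent_orthogonal.
Context d (T : measurableType d) (R : realType) (P : probability T R).

Lemma centered_normal_mean (X : T -> R) s : centered_normal P X s ->
  P.-integrable setT (EFin \o X) /\ \int[P]_w X w = 0.
Proof.
move=> [mX s0 law].
have iid : (normal_prob (0 : R) 1).-integrable setT (fun z => z%:E).
  by apply: (@integrable_normal_prob R id 1) => // z; rewrite mul1r normr_le_sqr.
have [] := @Rintegral_affine_normal _ _ _ P X 0 s id mX (@measurable_id _ _ _) law.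
  by under eq_fun do rewrite add0r; exact: (integrableZl measurableT s iid).
move=> iX /= ->; split => //.
under eq_Rintegral do rewrite add0r.
by rewrite RintegralZl// integral_id_normal_prob mulr0.
Qed.

(** Independence identifies the joint law with the product of the laws. Fubini then applies, since
    [X * Y] is integrable, and the inner integral is a multiple of the mean of [Y]. *)
Lemma independent_sprod0 (V : set (T -> R)) (X Y : T -> R) : gaussian_space P V ->
  V X -> V Y ->
  (forall A B : set R, measurable A -> measurable B ->
    P (X @^-1` A `&` Y @^-1` B) = (P (X @^-1` A) * P (Y @^-1` B))%E) ->
  sprod P X Y = 0.
Proof.
move=> gV VX VY ind.
have mX := gaussian_space_measurable gV VX.
have mY := gaussian_space_measurable gV VY.
pose X' : {mfun T >-> R} := HB.pack X (isMeasurableFun.Build _ _ _ _ _ mX).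
pose Y' : {mfun T >-> R} := HB.pack Y (isMeasurableFun.Build _ _ _ _ _ mY).
have mXY : measurable_fun setT (fun w => (X w, Y w)) by exact: measurable_fun_pair.
pose XY' : {mfun T >-> (R * R)%type} := HB.pack (fun w => (X w, Y w)) (isMeasurableFun.Build _ _ _ _ _ mXY).
pose m1 := distribution P X'; pose m2 := distribution P Y'.
have law (C : set (R * R)) : measurable C -> (m1 \x m2)%E C = P ((fun w => (X w, Y w)) @^-1` C).
  move=> mC; rewrite -[RHS]/(distribution P XY' C).
  by apply: product_measure_unique => // A B mA mB; exact: ind.
have mf : measurable_fun setT (fun z : R * R => z.1 * z.2).
  by apply: measurable_funM; [exact: measurable_fst|exact: measurable_snd].
have [] := @Rintegral_same_law _ _ _ _ T _ R (m1 \x m2)%E P id (fun w => (X w, Y w))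
  (fun z : R * R => z.1 * z.2) (@measurable_id _ _ _) mXY mf law (integrable_sprod gV VX VY).
move=> ip; rewrite /sprod => <-.
rewrite /Rintegral /= -(integral12_prod_meas1 ip).
have [sY cY] := (proj2 gV) _ VY; have [iY mean0] := centered_normal_mean cY.
have intY : (\int[m2]_y y%:E = 0)%E.
  rewrite (@integral_distribution _ _ _ _ R P Y' EFin (@EFin_measurable R setT) iY).
  have := integrable_fin_num measurableT iY => /fineK <-.
  by move: mean0; rewrite /Rintegral => ->.
have im2 : m2.-integrable setT (fun y : R => y%:E).
  by apply: integrable_pushforward => //; exact: EFin_measurable.
rewrite (_ : fubini_F _ _ = cst 0%E) ?integral0//.
apply/funext => x; rewrite /fubini_F /=; under eq_integral do rewrite EFinM.
by rewrite integralZl// intY mule0.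
Qed.

End independent_orthogonal.

(** * Approximating the operators by finite combinations of evaluations *)

Section sequential_continuity.
Context (R : realType) (d : nat) (Di : 'I_d -> set R).
Local Notation D := (product_set Di).

(** The form in which continuity is used: dominated convergence and the Gaussian limit theorem deal
    with sequences, and grid points converge coordinatewise. *)
Definition seq_continuous (f : 'rV[R]_d -> R) := forall (x_ : nat -> 'rV[R]_d) x,
  (forall n, D (x_ n)) -> D x -> (forall j, x_ n ord0 j @[n --> \oo] --> x ord0 j) ->
  f (x_ n) @[n --> \oo] --> f x.

Lemma within_seq_continuous f : {within D, continuous f} -> seq_continuous f.
Proof.
move=> /subspace_continuousP cf x_ x Dx_ Dx xx.
have cx : x_ n @[n --> \oo] --> x.
  apply/cvg_ballP => e e0.
  have : \forall n \near \oo, forall j, ball (x ord0 j) e (x_ n ord0 j).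
    by apply: filter_forall => j; exact: (cvg_ball (xx j)).
  apply: filterS => n H; rewrite /ball /= /mx_ball; split => // i j.
  by rewrite (ord1 i); exact: H.
apply: (cvg_comp x_ f _ (cf x Dx)) => A; rewrite /within /= => nA.
near=> n; have : D (x_ n) -> A (x_ n) by near: n; exact: (cx _ nA).
by apply.
Unshelve. all: by end_near. Qed.

(** Gives access to compactness, hence to boundedness. If it failed, points tending to [x] would
    keep their values at distance [e] from [f x]. *)
Lemma seq_continuous_within f : seq_continuous f -> {within D, continuous f}.
Proof.
move=> sf; apply/subspace_continuousP => x Dx; apply/cvgrPdist_lt => e e0.
apply: contrapT => nH.
have /choice [y Hy] : forall n : nat, exists y, [/\ D y, ball x (n.+1%:R^-1) y & e <= `|f x - f y|].
  move=> n; apply: contrapT => H; apply: nH; rewrite /within /=.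
  have nb : nbhs x (ball x (n.+1%:R^-1 : R)) by apply: nbhsx_ballx; rewrite invr_gt0.
  apply: (filterS _ nb).
  move=> y xy Dy; rewrite ltNge; apply/negP => ey; apply: H; by exists y.
have : f (y n) @[n --> \oo] --> f x.
  apply: sf => // [n|j]; first by have [] := Hy n.
  apply/cvgrPdist_lt => e' e'0; near=> n.
  have [_ + _] := Hy n; rewrite /ball /= /mx_ball => -[_ /(_ ord0 j)] /lt_trans; apply.
  near: n; apply: (cvgr_lt _ (@cvg_harmonic R)) => //.
move=> /cvgrPdist_lt /(_ _ e0) [N _ /(_ N (leqnn _))] /=.
by have [_ _] := Hy N; rewrite leNgt => /negP.
Unshelve. all: by end_near. Qed.

Hypothesis Di_compact : forall i, compact (Di i).

Lemma seq_continuous_bounded f : seq_continuous f -> exists M, forall x, D x -> `|f x| <= M.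
Proof.
move=> /seq_continuous_within cf.
have cD : compact D by exact: rV_compact.
have [M [_ HM]] := compact_bounded (continuous_compact cf cD).
exists (M + 1) => x Dx; apply: (HM (M + 1)); first by rewrite ltrDl.
by exists x.
Qed.

End sequential_continuity.

Section finite_partition.
Context d (T : measurableType d) (R : realType) (P : probability T R).

Lemma Rintegral_sum (S : set T) (I : Type) (r : seq I) (f : I -> T -> R) : measurable S ->
  (forall i, P.-integrable S (EFin \o f i)) ->
  P.-integrable S (fun t => (\sum_(i <- r) f i t)%:E) /\
  \int[P]_(t in S) (\sum_(i <- r) f i t) = \sum_(i <- r) \int[P]_(t in S) f i t.
Proof.
move=> mS intf; elim: r => [|i r [IH1 IH2]].
  split; first by under eq_fun do rewrite big_nil; exact: integrable0.
  rewrite big_nil; under eq_Rintegral do rewrite big_nil.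
  by rewrite Rintegral_cst// mul0r.
split.
  under eq_fun do rewrite big_cons.
  exact: (integrableD mS (intf i) IH1).
rewrite big_cons -IH2 -RintegralD//.
by apply: eq_Rintegral => t _; rewrite big_cons.
Qed.

Variables (I : finType) (phi : T -> I).
Hypothesis mphi : forall j, measurable (phi @^-1` [set j]).

Let decomp (g : I -> R) t : g (phi t) = \sum_j g j * \1_(phi @^-1` [set j]) t.
Proof.
rewrite (bigD1 (phi t))//= big1 => [|j jt].
  by rewrite addr0 indicE mem_set//= mulr1.
by rewrite indicE memNset/= ?mulr0// => e; rewrite e eqxx in jt.
Qed.

Lemma measurable_finite_range (S : set T) (g : I -> R) :
  measurable_fun S (fun t => g (phi t)).
Proof.
under eq_fun do rewrite decomp.
by apply: measurable_sum => j; apply: measurable_funM => //; exact: measurable_indic.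
Qed.

Lemma Rintegral_finite_range (S : set T) (g : I -> R) : measurable S ->
  \int[P]_(t in S) g (phi t) = \sum_j g j * fine (P (S `&` phi @^-1` [set j])).
Proof.
move=> mS; under eq_Rintegral do rewrite decomp.
have iind j : P.-integrable S (EFin \o \1_(phi @^-1` [set j])).
  apply: (@bounded_integrable _ _ _ P S _ 1) => //.
  by move=> w _; rewrite indicE; case: (_ \in _); rewrite ?normr1 ?normr0.
have [|_ ->] := @Rintegral_sum S I (index_enum I) (fun j t => g j * \1_(phi @^-1` [set j]) t) mS.
  by move=> j; exact: (integrableZl mS (g j) (iind j)).
apply: eq_bigr => j _; rewrite RintegralZl//.
by rewrite /Rintegral integral_indic// setIC.
Qed.

End finite_partition.

Section coordinates.
Context (R : realType) (d : nat).
Variable A : {set 'I_d}.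

Lemma set_coords_in (x : 'rV[R]_d) (t : #|A|.-tuple R) (i : 'I_#|A|) :
  set_coords x t ord0 (enum_val i) = tnth t i.
Proof.
rewrite mxE (tnth_nth (x ord0 (enum_val i))); congr nth.
rewrite (enum_val_nth (enum_val i)) index_uniq ?enum_uniq// -cardE.
exact: ltn_ord.
Qed.

Lemma set_coords_out (x : 'rV[R]_d) (t : #|A|.-tuple R) (j : 'I_d) :
  j \notin A -> set_coords x t ord0 j = x ord0 j.
Proof.
move=> jA; rewrite mxE nth_default// size_tuple memNindex ?mem_enum//.
by rewrite -cardE.
Qed.

Lemma enum_valE (j : 'I_d) : j \in A -> exists i : 'I_#|A|, enum_val i = j.
Proof. by move=> jA; exists (enum_rank_in jA j); rewrite enum_rankK_in. Qed.

Lemma product_set_coords (Di : 'I_d -> set R) x t : product_set Di x ->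
  subproduct_set Di A t -> product_set Di (set_coords x t).
Proof.
move=> Dx St j; have [/enum_valE[i <-]|jA] := boolP (j \in A).
  by rewrite set_coords_in; exact: St.
by rewrite set_coords_out//; exact: Dx.
Qed.

Lemma cvg_set_coords (x_ : nat -> 'rV[R]_d) (x : 'rV[R]_d)
    (t_ : nat -> #|A|.-tuple R) (t : #|A|.-tuple R) :
  (forall j, x_ n ord0 j @[n --> \oo] --> x ord0 j) ->
  (forall i, tnth (t_ n) i @[n --> \oo] --> tnth t i) ->
  forall j, set_coords (x_ n) (t_ n) ord0 j @[n --> \oo] --> set_coords x t ord0 j.
Proof.
move=> xx tt j; have [/enum_valE[i <-]|jA] := boolP (j \in A).
  by rewrite set_coords_in; under eq_fun do rewrite set_coords_in; exact: tt.
by rewrite set_coords_out//; under eq_fun do rewrite set_coords_out//; exact: xx.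
Qed.

End coordinates.

(** * Grids of mesh $1/(n+1)$ *)

Section cells.
Context (R : realType) (d : nat) (Di : 'I_d -> set R).
Variables (a : 'I_d -> R) (M : R).
Hypothesis Da : forall i, Di i (a i).
Hypothesis DM : forall i x, Di i x -> `|x| <= M.

Definition cell_count n := Num.truncn (2 * M * n.+1%:R).

Definition cell n (x : R) : 'I_(cell_count n).+1 :=
  inord (Num.truncn ((x + M) * n.+1%:R)).

(* A point of [Di i] in the cell [j], and the default [a i] when that cell is empty. *)
Definition cell_point n (i : 'I_d) (j : 'I_(cell_count n).+1) : R :=
  xget (a i) [set y | Di i y /\ cell n y = j].

Lemma cell_point_in n i j : Di i (@cell_point n i j).
Proof. by rewrite /cell_point; case: xgetP => [y -> []|]. Qed.

Lemma measurable_cell n j : measurable (cell n @^-1` [set j]).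
Proof.
pose g (x : R) := (x + M) * n.+1%:R.
have mg : measurable_fun setT g by apply: measurable_funM => //; exact: measurable_funD.
have mk (k : nat) : measurable ((fun x => Num.truncn (g x)) @^-1` [set k]).
  (* The guard [k != 0] is there because truncation sends negative numbers to 0. *)
  rewrite (_ : _ @^-1` _ = (g @^-1` [set x | x < k.+1%:R]) `\` (g @^-1` [set x | (k != 0)%N /\ x < k%:R])).
    apply: measurableD.
      by rewrite -[X in measurable X]setTI -set_itvNyo; exact: mg.
    case: k => [|k]; first by rewrite (_ : _ @^-1` _ = set0)//; apply/seteqP; split => // x [].
    rewrite (_ : [set x | _] = [set x | x < k.+1%:R]).
      by rewrite -[X in measurable X]setTI -set_itvNyo; exact: mg.
    by apply/seteqP; split => x // [].
  apply/seteqP; split => x /=.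
    move=> <-; rewrite -truncn_le_nat; split => // -[].
    by case E : (Num.truncn (g x)) => [|k1] // _; rewrite -truncn_le_nat E ltnn.
  rewrite -truncn_le_nat => -[gk ngk]; apply/eqP; rewrite eqn_leq gk /=.
  case: k ngk {gk} => // k ngk; rewrite ltnNge truncn_le_nat; apply/negP => ?.
  by apply: ngk.
rewrite (_ : _ @^-1` _ = \bigcup_(k in [set k : nat | inord k = j]) ((fun x => Num.truncn (g x)) @^-1` [set k])).
  by apply: bigcup_measurable => k _; exact: mk.
apply/seteqP; split => x /=.
  by move=> e; exists (Num.truncn (g x)).
by move=> [k /= <- <-].
Qed.

(** The cell of [x] contains [x], so the default is not taken, and two points of [Di i] in one cell
    are less than $1/(n+1)$ apart. *)
Lemma cvg_cell_point i x : Di i x -> cell_point i (cell n x) @[n --> \oo] --> x.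
Proof.
move=> Dx; apply/cvgrPdist_lt => e e0; near=> n.
have : (n.+1%:R^-1 : R) < e by near: n; exact: (cvgr_lt _ (@cvg_harmonic R)).
apply: lt_trans; rewrite /cell_point; case: xgetP => [y _ [Dy yx]|/(_ x)]; last by case.
have K z : Di i z -> 0 <= (z + M) * n.+1%:R /\ (Num.truncn ((z + M) * n.+1%:R) < (cell_count n).+1)%N.
  move=> /DM; rewrite ler_norml => /andP[z1 z2]; split.
    by rewrite mulr_ge0//; lra.
  by rewrite ltnS; apply: le_truncn; rewrite ler_wpM2r//; lra.
have [x0 xK] := K _ Dx; have [y0 yK] := K _ Dy.
have /(congr1 val) := yx; rewrite /cell /= !inordK// => E.
have /andP[] := truncn_itv x0; have /andP[] := truncn_itv y0; rewrite E.
set N : R := n.+1%:R; have N0 : 0 < N by rewrite /N.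
rewrite -natr1 => h1 h2 h3 h4.
rewrite -[ltRHS]mul1r ltr_pdivlMr// -[X in _ * X](gtr0_norm N0) -normrM.
by rewrite ltr_norml; apply/andP; split; lra.
Unshelve. all: by end_near. Qed.

End cells.

Lemma cvg_big_sum (R : realType) (I : Type) (r : seq I) (p : pred I)
    (F : I -> R^nat) (l : I -> R) : (forall i, F i n @[n --> \oo] --> l i) ->
  \sum_(i <- r | p i) F i n @[n --> \oo] --> \sum_(i <- r | p i) l i.
Proof.
move=> Fl; elim: r => [|i r IH].
  by rewrite big_nil; under eq_fun do rewrite big_nil; exact: cvg_cst.
by rewrite big_cons; under eq_fun do rewrite big_cons; case: (p i) => //; exact: cvgD.
Qed.

Section approximation.
Context (R : realType) (d : nat) (Di : 'I_d -> set R).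
Hypothesis Di_compact : forall i, compact (Di i).
Variable a : 'I_d -> R.
Hypothesis Da : forall i, Di i (a i).
Variable nu : 'I_d -> probability R R.
Local Notation D := (product_set Di).

Lemma common_bound : exists M : R, forall i x, Di i x -> `|x| <= M.
Proof.
have /choice [m Hm] : forall i, exists m, forall x, Di i x -> `|x| <= m.
  move=> i; have [m [_ Hm]] := compact_bounded (@Di_compact i).
  by exists (m + 1) => x Dx; apply: (Hm (m + 1)) => //; rewrite ltrDl.
(* The sum dominates each bound because the others are nonnegative, [Di j] being inhabited by
   [a j]. *)
exists (\sum_i m i) => i x Dx; rewrite (le_trans (Hm _ _ Dx))// (bigD1 i)//= lerDl.
by apply: sumr_ge0 => j _; rewrite (le_trans _ (Hm _ _ (Da j))).
Qed.

Lemma measurable_compact i : measurable (Di i).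
Proof. by apply: closed_measurable; apply: compact_closed => //; exact: norm_hausdorff. Qed.

Definition evaluation (s : seq (R * 'rV[R]_d)) (f : 'rV[R]_d -> R) : R :=
  \sum_(p <- s) p.1 * f p.2.

(** [s] is chosen before [f]: the same nodes and weights serve every path and every function $x
    \mapsto E(Z_x Y)$, which is what lets [L] cross the expectation. *)
Definition approximable (L : ('rV[R]_d -> R) -> R) :=
  exists2 s : nat -> seq (R * 'rV[R]_d), forall n p, p \in s n -> D p.2 &
    forall f, seq_continuous Di f -> evaluation (s n) f @[n --> \oo] --> L f.

Lemma approximable_lin (b : R) L L' : approximable L -> approximable L' ->
  approximable (fun f => b * L f + L' f).
Proof.
move=> [s sD sL] [s' s'D s'L].
exists (fun n => [seq (b * p.1, p.2) | p <- s n] ++ s' n).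
  move=> n p; rewrite mem_cat => /orP[/mapP[q qs ->]|]; last exact: s'D.
  exact: (sD n q qs).
move=> f sf; rewrite (_ : (fun n => _) = (fun n => b * evaluation (s n) f + evaluation (s' n) f)).
  apply: cvgD; last exact: s'L.
  by apply: cvgM; [exact: cvg_cst|exact: sL].
apply/funext => n; rewrite /evaluation big_cat/= big_map mulr_sumr; congr (_ + _).
by apply: eq_bigr => p _; rewrite mulrA.
Qed.

Lemma approximable0 : approximable (fun _ => 0).
Proof.
exists (fun _ => [::]) => // f _.
by rewrite /evaluation; under eq_fun do rewrite big_nil; exact: cvg_cst.
Qed.

Lemma approximable_sum (I : Type) (r : seq I) (p : pred I) (b : I -> R)
    (L : I -> ('rV[R]_d -> R) -> R) : (forall i, approximable (L i)) ->
  approximable (fun f => \sum_(i <- r | p i) b i * L i f).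
Proof.
move=> aL; elim: r => [|i r IH].
  by under eq_fun do rewrite big_nil; exact: approximable0.
under eq_fun do rewrite big_cons; case: (p i) => //.
exact: approximable_lin.
Qed.

(** All nodes lie in [D], so [L] sees only values on [D]; the covariance identities are available
    only there. *)
Lemma approximable_ext L f g : approximable L -> seq_continuous Di f ->
  (forall x, D x -> f x = g x) -> L f = L g.
Proof.
move=> [s sD sL] sf fg.
have sg : seq_continuous Di g.
  move=> x_ x Dx_ Dx xx; rewrite -fg// -(funext (fun n => fg _ (Dx_ n))).
  exact: sf.
apply: (cvg_unique _ (sL f sf)) => //.
rewrite (_ : (fun n => _) = (fun n => evaluation (s n) g)); first exact: sL.
by apply/funext => n; apply: eq_big_seq => p ps; rewrite fg//; exact: sD ps.
Qed.

Lemma approximable_eq0 L f : approximable L ->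
  (forall x, D x -> f x = 0) -> L f = 0.
Proof.
move=> aL f0; have s0 : seq_continuous Di (cst 0) by move=> *; exact: cvg_cst.
rewrite -(@approximable_ext L (cst 0) f)//; last by move=> x Dx; rewrite f0.
have [s sD sL] := aL; apply/esym/(cvg_unique _ _ (sL _ s0)) => //.
rewrite (_ : (fun n => _) = cst 0); first exact: cvg_cst.
by apply/funext => n; rewrite /evaluation big1// => p _; rewrite mulr0.
Qed.

Section integrate_out.
Variable u : {set 'I_d}.
Local Notation A := (~: u)%SET.
Local Notation mu := (subproduct_probability nu A).
Local Notation S := (subproduct_set Di A).

Lemma measurable_subproduct_set : measurable S.
Proof.
rewrite (_ : S = \bigcap_(i in [set: 'I_#|A|]) ((@tnth _ R ^~ i) @^-1` Di (enum_val i))).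
  apply: fin_bigcap_measurable => // i _; rewrite -[X in measurable X]setTI.
  by apply: measurable_tnth => //; exact: measurable_compact.
by apply/seteqP; split => t /= h i; [move=> _|]; exact: h.
Qed.

Lemma discretization : exists (I : nat -> finType) (node : forall n, I n -> #|A|.-tuple R)
  (phi : forall n, #|A|.-tuple R -> I n),
  [/\ forall n j, S (node n j), forall n j, measurable (phi n @^-1` [set j]) &
   forall t, S t -> forall i, tnth (node n (phi n t)) i @[n --> \oo] --> tnth t i].
Proof.
have [M HM] := common_bound.
exists (fun n => {ffun 'I_#|A| -> 'I_(cell_count M n).+1}).
exists (fun n (J : {ffun 'I_#|A| -> 'I_(cell_count M n).+1}) => [tuple cell_point Di a (enum_val i) (J i) | i < #|A|]).
exists (fun n t => [ffun i => cell M n (tnth t i)]); split.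
- by move=> n J i; rewrite tnth_mktuple; exact: cell_point_in.
- move=> n J.
  rewrite (_ : _ @^-1` _ = \bigcap_(i in [set: 'I_#|A|])
      ((@tnth _ R ^~ i) @^-1` (cell M n @^-1` [set J i]))).
    apply: fin_bigcap_measurable => // i _; rewrite -[X in measurable X]setTI.
    by apply: measurable_tnth => //; exact: measurable_cell.
  apply/seteqP; split => t /=; first by move=> <- i _; rewrite /= ffunE.
  by move=> H; apply/ffunP => i; rewrite ffunE; exact: H.
- move=> t St i.
  under eq_fun do rewrite tnth_mktuple ffunE.
  by apply: (cvg_cell_point a HM); exact: St.
Qed.

(** Riemann sums, a node being weighted by the measure of its cell. Measurability of the integrand
    follows too, as it is a limit of functions of finite range. *)
Lemma integrate_out_approx : exists (I : nat -> finType) (node : forall n, I n -> #|A|.-tuple R)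
  (b : forall n, I n -> R), (forall n j, S (node n j)) /\
  forall f x, seq_continuous Di f -> D x ->
    measurable_fun S (fun t => f (set_coords x t)) /\
    \sum_j b n j * f (set_coords x (node n j)) @[n --> \oo] --> integrate_out Di nu u f x.
Proof.
have [I [node [phi [nodeS mphi cvphi]]]] := discretization.
exists I, node, (fun n j => fine (mu (S `&` phi n @^-1` [set j]))); split => // f x sf Dx.
have cf t : S t -> f (set_coords x (node n (phi n t))) @[n --> \oo] --> f (set_coords x t).
  move=> St; apply: sf.
  - by move=> n; apply: product_set_coords.
  - exact: product_set_coords.
  - by apply: cvg_set_coords; [move=> j; exact: cvg_cst|exact: cvphi].
have mf n : measurable_fun S (fun t => f (set_coords x (node n (phi n t)))).
  exact: (measurable_finite_range (mphi n) (fun j => f (set_coords x (node n j)))).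
split; first exact: measurable_fun_cvg mf cf.
have [M HM] := seq_continuous_bounded Di_compact sf.
have mS := measurable_subproduct_set.
rewrite (_ : (fun n => _) = (fun n => \int[mu]_(t in S) f (set_coords x (node n (phi n t))))).
  apply: (@cvg_Rintegral_bounded _ _ _ mu S _ _ M) => //.
  by move=> n t St; apply: HM; apply: product_set_coords.
apply/funext => n.
rewrite (Rintegral_finite_range mu (mphi n) (fun j => f (set_coords x (node n j))) mS).
by apply: eq_bigr => j _; rewrite mulrC.
Qed.

Lemma approximable_integrate_out x : D x ->
  approximable (fun f => integrate_out Di nu u f x).
Proof.
move=> Dx; have [I [node [b [nodeS H]]]] := integrate_out_approx.
exists (fun n => [seq (b n j, set_coords x (node n j)) | j <- index_enum (I n)]).
  by move=> n p /mapP[j _ ->]; apply: product_set_coords.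
move=> f sf; have [_] := H f x sf Dx.
by rewrite /evaluation; under [in X in _ -> X]eq_fun do rewrite big_map.
Qed.

Lemma seq_continuous_integrate_out f : seq_continuous Di f ->
  seq_continuous Di (integrate_out Di nu u f).
Proof.
move=> sf x_ x Dx_ Dx xx; have [I [node [b [_ H]]]] := integrate_out_approx.
have [M HM] := seq_continuous_bounded Di_compact sf.
apply: (@cvg_Rintegral_bounded _ _ _ mu S _ _ M).
- exact: measurable_subproduct_set.
- by move=> n; have [] := H f (x_ n) sf (Dx_ n).
- move=> t St; apply: sf.
  + by move=> n; exact: product_set_coords.
  + exact: product_set_coords.
  + by apply: cvg_set_coords => // i; exact: cvg_cst.
- by move=> n t St; apply: HM; exact: product_set_coords.
Qed.

End integrate_out.

Lemma approximable_T_op u x : D x -> approximable (fun f => T_op Di nu u f x).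
Proof.
by move=> Dx; apply: approximable_sum => u'; exact: approximable_integrate_out.
Qed.

Lemma seq_continuous_T_op u f : seq_continuous Di f ->
  seq_continuous Di (T_op Di nu u f).
Proof.
move=> sf x_ x Dx_ Dx xx; rewrite /T_op.
apply: cvg_big_sum => u'; apply: cvgM; first exact: cvg_cst.
exact: seq_continuous_integrate_out.
Qed.

(** Density is stated through its use, the vanishing of continuous functions. Finite levels make
    intersections over the points visibly countable. *)
Lemma countable_dense : exists (I : nat -> finType) (q : forall n, I n -> 'rV[R]_d),
  (forall n j, D (q n j)) /\
  forall f, seq_continuous Di f -> (forall n j, f (q n j) = 0) ->
    forall x, D x -> f x = 0.
Proof.
have [M HM] := common_bound.
exists (fun n => {ffun 'I_d -> 'I_(cell_count M n).+1}).
exists (fun n (J : {ffun 'I_d -> 'I_(cell_count M n).+1}) => \row_i cell_point Di a i (J i)); split.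
  by move=> n J i; rewrite mxE; exact: cell_point_in.
move=> f sf f0 x Dx.
pose x_ n : 'rV[R]_d := \row_i cell_point Di a i (cell M n (x ord0 i)).
have E n : f (x_ n) = 0.
  rewrite -[RHS](f0 n [ffun i => cell M n (x ord0 i)]); congr f.
  by apply/rowP => i; rewrite !mxE ffunE.
have : f (x_ n) @[n --> \oo] --> f x.
  apply: sf => // [n i|j]; first by rewrite mxE; exact: cell_point_in.
  by under eq_fun do rewrite mxE; apply: (cvg_cell_point a HM); exact: Dx.
rewrite (funext E) => c; apply/esym/(cvg_unique _ _ c) => //; exact: cvg_cst.
Qed.

End approximation.

(** * The theorem *)

Section field.
Context (R : realType) (d : nat) (Di : 'I_d -> set R).
Hypothesis Di_compact : forall i, compact (Di i).
Variable a : 'I_d -> R.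
Hypothesis Da : forall i, Di i (a i).
Variable nu : 'I_d -> probability R R.
Context (disp : measure_display) (Omega : measurableType disp) (P : probability Omega R).
Variables (Z : 'rV[R]_d -> Omega -> R) (k : 'rV[R]_d -> 'rV[R]_d -> R).
Local Notation D := (product_set Di).
Hypothesis Z_gaussian : gaussian_field P D Z.
Hypothesis Z_mean : forall x, D x -> ('E_P[Z x] = 0)%E.
Hypothesis Z_cov : forall x y, D x -> D y -> covariance P (Z x) (Z y) = (k x y)%:E.
Hypothesis Z_cont : forall w, {within D, continuous (fun x => Z x w)}.

Let Z_seq w : seq_continuous Di (fun x => Z x w).
Proof. exact: within_seq_continuous. Qed.

Let sprod_Z x y : D x -> D y -> sprod P (Z x) (Z y) = k x y.
Proof.
move=> Dx Dy; have := Z_cov Dx Dy; rewrite covariance.unlock !Z_mean//= expectation.unlock => e.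
rewrite -[RHS]/(fine (k x y)%:E) -e /sprod /Rintegral; congr fine.
by apply: eq_integral => w _; rewrite !fctE /= !subr0.
Qed.

Let combinations : set (Omega -> R) := [set X | exists2 s : seq (R * 'rV[R]_d),
  forall p, p \in s -> D p.2 & X = fun w => evaluation s (fun x => Z x w)].

Let integrable_Z x : D x -> P.-integrable setT (EFin \o Z x) /\ \int[P]_w Z x w = 0.
Proof.
move=> Dx; split.
  have [_ /(_ 1%N (fun _ => x) (fun _ => Dx) (fun _ => 1))] := Z_gaussian.
  move=> /normal_variable_centered[+ _].
  rewrite (_ : (fun w => _) = Z x)//.
  by apply/funext => w; rewrite big_ord1 mul1r.
by have := Z_mean Dx; rewrite expectation.unlock /Rintegral => ->.
Qed.

Let gaussian_combinations : gaussian_space P combinations.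
Proof.
split; first split.
- by exists [::] => //; apply/funext => w; rewrite /evaluation big_nil.
- move=> b _ _ [s sD ->] [s' sD' ->].
  exists ([seq (b * p.1, p.2) | p <- s] ++ s').
    by move=> p; rewrite mem_cat => /orP[/mapP[q qs ->]|]; [exact: (sD q)|exact: sD'].
  apply/funext => w; rewrite /evaluation big_cat/= big_map mulr_sumr; congr (_ + _).
  by apply: eq_bigr => p _; rewrite mulrA.
move=> _ [s sD ->].
pose n := size s; pose c (i : 'I_n) := (tnth (in_tuple s) i).1.
pose x (i : 'I_n) := (tnth (in_tuple s) i).2.
have Dx i : D (x i) by apply: sD; exact: mem_tnth.
have E w : evaluation s (fun x => Z x w) = \sum_(i < n) c i * Z (x i) w.
  by rewrite /evaluation big_tnth.
rewrite (funext E).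
have [_ /(_ n x Dx c)] := Z_gaussian.
move=> /normal_variable_centered[_]; apply.
have [|_ ->] := @Rintegral_sum _ _ _ P setT 'I_n (index_enum 'I_n) (fun i w => c i * Z (x i) w) measurableT.
  by move=> i; have [iZ _] := integrable_Z (Dx i); exact: (integrableZl measurableT (c i) iZ).
rewrite big1// => i _; have [iZ eZ] := integrable_Z (Dx i).
by rewrite RintegralZl// eZ mulr0.
Qed.

Let V := limit_closure combinations.

Let gV : gaussian_space P V.
Proof. exact: gaussian_limit_closure. Qed.

Let VZ x : D x -> V (Z x).
Proof.
move=> Dx; apply: sub_limit_closure; exists [:: (1, x)].
  by move=> p; rewrite inE => /eqP ->.
by apply/funext => w; rewrite /evaluation big_seq1 mul1r.
Qed.

Let VL L : approximable Di L -> V (fun w => L (fun x => Z x w)).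
Proof.
move=> [s sD sL]; exists (fun n w => evaluation (s n) (fun x => Z x w)).
  by move=> n; exists (s n) => //; exact: sD.
by move=> w; exact: sL.
Qed.

(** Continuity of the covariance is deduced from that of the paths, through convergence of second
    moments. *)
Let seq_continuous_sprod Y : V Y -> seq_continuous Di (fun x => sprod P (Z x) Y).
Proof.
move=> VY x_ x Dx_ Dx xx.
apply: (cvg_sprod gV (X_ := fun n => Z (x_ n)) (Y_ := fun _ => Y)) => //.
- by move=> n; exact: VZ.
- exact: VZ.
- by move=> w; exact: Z_seq.
- by move=> w; exact: cvg_cst.
Qed.

Let sprod_evaluation s Y : (forall p, p \in s -> D p.2) -> V Y ->
  sprod P (fun w => evaluation s (fun x => Z x w)) Y =
  evaluation s (fun x => sprod P (Z x) Y).
Proof.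
move=> sD VY; elim: s sD => [|p s IH] sD.
  rewrite /evaluation big_nil -[RHS](sprod0l P Y); congr sprod.
  by apply/funext => w; rewrite big_nil.
have sD' q : q \in s -> D q.2 by move=> qs; apply: sD; rewrite inE qs orbT.
transitivity (p.1 * sprod P (Z p.2) Y + evaluation s (fun x => sprod P (Z x) Y)); last first.
  by rewrite /evaluation big_cons.
rewrite -IH// -(sprodDl gV)//.
- by congr sprod; apply/funext => w; rewrite /evaluation big_cons.
- by apply: VZ; apply: sD; rewrite inE eqxx.
- by apply: sub_limit_closure; exists s.
Qed.

(** The substitute for Fubini: both sides are limits of the same sequence, by [cvg_sprod] on the
    left and by continuity of the covariance on the right. *)
Let sprod_functional L Y : approximable Di L -> V Y ->
  sprod P (fun w => L (fun x => Z x w)) Y = L (fun x => sprod P (Z x) Y).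
Proof.
move=> aL VY; have [s sD sL] := aL.
have c1 := sL _ (seq_continuous_sprod VY).
apply: (cvg_unique _ _ c1) => //.
rewrite -(funext (fun n => sprod_evaluation (sD n) VY)).
apply: (cvg_sprod gV (Y_ := fun _ => Y)) => //.
- by move=> n; apply: sub_limit_closure; exists (s n) => //; exact: sD.
- exact: VL.
- by move=> w; exact: sL.
- by move=> w; exact: cvg_cst.
Qed.

Let Zu (u : {set 'I_d}) x w := T_op Di nu u (fun x' => Z x' w) x.

Let IO (u : {set 'I_d}) x w := integrate_out Di nu u (fun x' => Z x' w) x.

Let V_IO u x : D x -> V (IO u x).
Proof. by move=> Dx; exact: (VL (approximable_integrate_out Di_compact Da nu u Dx)). Qed.

Let V_Zu u x : D x -> V (Zu u x).
Proof. by move=> Dx; exact: (VL (approximable_T_op Di_compact Da nu u Dx)). Qed.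

Let sprod_IO u v x y : D x -> D y -> sprod P (IO u x) (IO v y) =
  integrate_out Di nu v (fun y' => integrate_out Di nu u (fun x' => k x' y') x) y.
Proof.
move=> Dx Dy; have au := approximable_integrate_out Di_compact Da nu u Dx.
have av := approximable_integrate_out Di_compact Da nu v Dy.
rewrite sprodC (sprod_functional av (V_IO u Dx)).
apply: (approximable_ext av); first by apply: seq_continuous_sprod; exact: V_IO.
move=> y' Dy'; rewrite sprodC (sprod_functional au (VZ Dy')).
apply: (approximable_ext au); first by apply: seq_continuous_sprod; exact: VZ.
by move=> x' Dx'; exact: sprod_Z.
Qed.

Let V_sum (I : Type) (r : seq I) (p : pred I) (c : I -> R) (X : I -> Omega -> R) :
  (forall i, V (X i)) -> V (fun w => \sum_(i <- r | p i) c i * X i w).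
Proof.
move=> VX; have [[V0 VD] _] := gV; elim: r => [|i r IH].
  by under eq_fun do rewrite big_nil.
by under eq_fun do rewrite big_cons; case: (p i) => //; exact: VD.
Qed.

Let sprod_sum (I : Type) (r : seq I) (p : pred I) (c : I -> R) (X : I -> Omega -> R) Y :
  (forall i, V (X i)) -> V Y ->
  sprod P (fun w => \sum_(i <- r | p i) c i * X i w) Y =
  \sum_(i <- r | p i) c i * sprod P (X i) Y.
Proof.
move=> VX VY; elim: r => [|i r IH].
  rewrite big_nil -[RHS](sprod0l P Y); congr sprod.
  by apply/funext => w; rewrite big_nil.
rewrite big_cons; under eq_fun do rewrite big_cons.
case: (p i) => //; rewrite (sprodDl gV) ?IH//.
exact: V_sum.
Qed.

Let TT_opE u v x y : D x -> D y ->
  TT_op Di nu u v k x y = sprod P (Zu u x) (Zu v y).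
Proof.
move=> Dx Dy; rewrite /Zu /T_op sprod_sum//; last 2 first.
- by move=> u'; exact: V_IO.
- by apply: V_sum => v'; exact: V_IO.
apply: eq_bigr => u' u'u; rewrite sprodC sprod_sum//; last 2 first.
- by move=> v'; exact: V_IO.
- exact: V_IO.
rewrite mulr_sumr; apply: eq_bigr => v' v'v.
rewrite sprodC sprod_IO// mulrA -exprD; congr (_ ^+ _ * _).
(* The exponents use truncated subtraction; they agree because a subset is no larger than its
   superset. *)
by have := subset_leq_card u'u; have := subset_leq_card v'v; lia.
Qed.

Let T_opE u x y : D x -> D y -> T_op Di nu u (fun x' => k x' y) x = sprod P (Zu u x) (Z y).
Proof.
move=> Dx Dy; have au := approximable_T_op Di_compact Da nu u Dx.
rewrite (sprod_functional au (VZ Dy)).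
apply/esym/(approximable_ext au); first by apply: seq_continuous_sprod; exact: VZ.
by move=> x' Dx'; exact: sprod_Z.
Qed.

Let seq_Zu u w : seq_continuous Di (fun x => Zu u x w).
Proof. exact: (seq_continuous_T_op Di_compact Da (Z_seq (w := w))). Qed.


Lemma vanishing_field_tfae (u : {set 'I_d}) :
    [<-> forall y, D y -> forall x, D x -> T_op Di nu u (fun x' => k x' y) x = 0;
         forall x y, D x -> D y -> TT_op Di nu u u k x y = 0;
         forall x, D x -> TT_op Di nu u u k x x = 0;
         P [set w | forall x, D x -> Zu u x w = 0] = 1%E].
Proof.
have [I [q [qD qdense]]] := countable_dense Di_compact Da.
have mZu x : D x -> measurable_fun setT (Zu u x).
  by move=> Dx; apply: (gaussian_space_measurable gV); exact: V_Zu.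
have mZ0 x : D x -> measurable (Zu u x @^-1` [set 0]).
  by move=> Dx; rewrite -[X in measurable X]setTI; exact: mZu.
set E := [set w | _].
(* Only this countable form shows that [E] is measurable, and that it has probability 1 once each of
   its sets does. *)
have EE : E = \bigcap_n \bigcap_(j in [set: I n]) (Zu u (q n j) @^-1` [set 0]).
  apply/seteqP; split => w /=; first by move=> H n _ j _; exact: H.
  by move=> H; apply: (qdense _ (seq_Zu (u := u) (w := w))) => n j; exact: H.
have mE : measurable E.
  rewrite EE; apply: bigcap_measurable => // n _; apply: fin_bigcap_measurable => // j _.
  exact: mZ0.
tfae.
(* The covariance of [Zu u x] and [Zu u y] is [T_u] applied to $y' \mapsto E(Z^{(u)}_x Z_{y'})$,
   which vanishes on [D] by hypothesis. *)
- move=> H x y Dx Dy; rewrite TT_opE//; have au := approximable_T_op Di_compact Da nu u Dy.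
  rewrite sprodC (sprod_functional au (V_Zu u Dx)); apply: (approximable_eq0 au).
  by move=> y' Dy'; rewrite sprodC -T_opE// H.
- by move=> H x Dx; exact: H.
- move=> H.
  have ae0 x : D x -> \forall w \ae P, Zu u x w = 0.
    move=> Dx; have [s cs es] := gaussian_space_sd gV (V_Zu u Dx).
    (* The diagonal value is the variance of [Zu u x], whose law is therefore the Dirac mass at
       0. *)
    have s0 : s = 0 by apply/eqP; rewrite -sqrf_eq0 es -TT_opE// H.
    apply/negligibleP; first by apply: measurableC; exact: mZ0.
    suff : P (~` (Zu u x @^-1` [set 0])) = 0%E by [].
    rewrite probability_setC; last exact: mZ0.
    have [_ _ ->] := cs; last by [].
    rewrite (_ : _ @^-1` _ = setT); first by rewrite [X in (1 - X)%E]probability_setT subee.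
    by apply/seteqP; split => // z _; rewrite /affine /= s0 mul0r addr0.
  have aeE : \forall w \ae P, forall n j, Zu u (q n j) w = 0.
    by apply: ae_foralln => n; apply: filter_forall => j; exact: ae0.
  have : P (~` E) = 0%E.
    apply: measure_negligible; first exact: measurableC.
    apply: negligibleS aeE => w nEw H'; apply: nEw; rewrite EE => n _ j _; exact: H'.
  rewrite probability_setC// => /eqP; rewrite sube_eq ?fin_num_measure// add0e => /eqP.
  by move=> /esym.
- move=> PE y Dy x Dx; rewrite T_opE// /sprod.
  rewrite -(Rintegral_cst_probability P 0) /Rintegral; congr fine.
  apply: ae_eq_integral => //.
    apply/measurable_EFinP; apply: measurable_funM; first exact: mZu.
    by apply: (gaussian_space_measurable gV); exact: VZ.
    by apply/measurable_EFinP; exact: measurable_cst.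
  exists (~` E); split; first exact: measurableC.
    by suff : P (~` E) = 0%E by []; rewrite probability_setC// PE subee.
  move=> w /= nH Ew; apply: nH => _; rewrite Ew//= mul0r//.
Qed.

Lemma uncorrelated_iff_independent_fields (u v : {set 'I_d}) :
  (forall x y, D x -> D y -> TT_op Di nu u v k x y = 0) <->
     [/\ gaussian_field P D (Zu u), gaussian_field P D (Zu v)
       & independent_fields P D (Zu u) (Zu v)].
Proof.
split.
  move=> H; split.
  - by apply: (gaussian_space_field gV) => x; exact: V_Zu.
  - by apply: (gaussian_space_field gV) => x; exact: V_Zu.
  (* [W1] is the orthogonal complement in [V] of the second field, and [W2] that of [W1]: linear
     spaces containing the two fields, orthogonal by construction. *)
  pose W1 : set (Omega -> R) := [set X | V X /\ forall y, D y -> sprod P X (Zu v y) = 0].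
  pose W2 : set (Omega -> R) := [set Y | V Y /\ forall X, W1 X -> sprod P X Y = 0].
  have [[V0 VD] _] := gV.
  apply: (@orthogonal_independent _ _ _ P V W1 W2 gV).
  - split; first by split => // y Dy; exact: sprod0l.
    move=> b X Y [VX HX] [VY HY]; split; first exact: VD.
    by move=> y Dy; rewrite (sprodDl gV _ VX VY (V_Zu v Dy)) HX// HY// mulr0 addr0.
  - split; first by split => // X _; rewrite sprodC; exact: sprod0l.
    move=> b X Y [VX HX] [VY HY]; split; first exact: VD.
    move=> X' WX'; rewrite (sprodDr gV)//; last by have [] := WX'.
    by rewrite HX// HY// mulr0 addr0.
  - by move=> X [].
  - by move=> X [].
  - by move=> X Y WX [_]; apply.
  - move=> x Dx; split; first exact: V_Zu.
    by move=> y Dy; rewrite -TT_opE// H.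
  - move=> y Dy; split; first exact: V_Zu.
    by move=> X [_]; apply.
move=> [_ _ ind] x y Dx Dy; rewrite TT_opE//.
apply: (independent_sprod0 gV); [exact: V_Zu|exact: V_Zu|].
move=> A B mA mB; apply: ind; apply: sub_gen_smallest.
  by exists x => //; exists A => //; rewrite setTI.
by exists y => //; exists B => //; rewrite setTI.
Qed.

End field.

Theorem corollary2 (R : realType) (d : nat) (d_ge1 : (1 <= d)%N)
    (Di : 'I_d -> set R) (Di_compact : forall i, compact (Di i))
    (nu : 'I_d -> probability R R) (nu_Di : forall i, nu i (Di i) = 1%E)
    (disp : measure_display) (Omega : measurableType disp)
    (P : probability Omega R)
    (Z : 'rV[R]_d -> Omega -> R) (k : 'rV[R]_d -> 'rV[R]_d -> R) :
  let D := product_set Di in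
  let T := T_op Di nu in
  let TT := TT_op Di nu in
  let Zu := fun (u : {set 'I_d}) (x : 'rV[R]_d) (w : Omega) =>
    T u (fun x' => Z x' w) x in
  gaussian_field P D Z ->
  (forall x, D x -> ('E_P[Z x] = 0)%E) ->
  (forall x y, D x -> D y -> covariance P (Z x) (Z y) = (k x y)%:E) ->
  (forall w, {within D, continuous (fun x => Z x w)}) ->
  (forall u : {set 'I_d},
    [<-> forall y, D y -> forall x, D x -> T u (fun x' => k x' y) x = 0;
         forall x y, D x -> D y -> TT u u k x y = 0;
         forall x, D x -> TT u u k x x = 0;
         P [set w | forall x, D x -> Zu u x w = 0] = 1%E]) /\
  (forall u v : {set 'I_d}, u != v ->
    ((forall x y, D x -> D y -> TT u v k x y = 0) <->
     [/\ gaussian_field P D (Zu u), gaussian_field P D (Zu v)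
       & independent_fields P D (Zu u) (Zu v)])).
Proof.
move=> D T TT Zu gZ mZ cZ pZ.
(* A set of probability 1 is inhabited; the chosen points are the defaults for empty cells. *)
have /choice [a Da] : forall i, exists x, Di i x.
  move=> i; apply: contrapT => H; have := nu_Di i.
  rewrite (_ : Di i = set0); last by apply/seteqP; split => // x Dx; apply: H; exists x.
  by rewrite measure0 => /esym/eqP; rewrite onee_eq0.
split=> [u|u v _]; first exact: (vanishing_field_tfae Di_compact Da nu gZ mZ cZ pZ u).
exact: (uncorrelated_iff_independent_fields Di_compact Da nu gZ mZ cZ pZ u v).
Qed.
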